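(* Let $X_0$ be a finite connected (polygonal) 2-complex whose fundamental group $\Gamma_0=\pi_1(X_0)$ has property $(\tau)$. Then there is a constant $C$ depending only on $X_0$ such that for every finite index normal subgroup $\Gamma\unlhd\Gamma_0$, with $X=\widetilde X_0/\Gamma$ the corresponding finite cover of $X_0$, one has $$(\xi_2(X;\mathbb{Z})-1)\,\rho_1(X;\mathbb{Z})-C\bigl(1+\log([\Gamma_0:\Gamma])\bigr)\le C\log\#\Gamma^{ab}.$$ In particular, for a residual tower of covers $X_i=\widetilde X_0/\Gamma_i\to X_0$, one has $$\xi_2(X_i;\mathbb{Z})\,\rho_1(X_i;\mathbb{Z})-o([\Gamma_0:\Gamma_i])\le C\log\#\Gamma_i^{ab}\qquad (i\to\infty),$$ where $o([\Gamma_0:\Gamma_i])$ denotes a quantity whose ratio to $[\Gamma_0:\Gamma_i]$ tends to $0$ as $i\to\infty$.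
   Context: A (polygonal) 2-complex is a cell complex of dimension 2 whose 2-cells are regular polygons with every boundary edge of length $1$, attached along edge loops. Covers carry the lifted cell structure; $\widetilde X_0$ is the universal cover. $\Gamma^{ab}$ is the abelianization of $\Gamma$ and $\#$ denotes cardinality. Property $(\tau)$ is meant with respect to all finite index normal subgroups: for a finite generating set $S$ of $\Gamma_0$ the Cayley graphs of the quotients $\Gamma_0/N$ with respect to the image of $S$, $N$ ranging over all finite index normal subgroups, form a family of expanders (uniform spectral gap). In this case every finite index normal subgroup has finite abelianization. A residual tower of covers is the sequence of covers associated to a nested sequence $\Gamma_0\ge\Gamma_1\ge\Gamma_2\ge\cdots$ of finite index normal subgroups of $\Gamma_0$ with $\bigcap_i\Gamma_i=\{1\}$ and $[\Gamma_0:\Gamma_i]\to\infty$. For a finite 2-complex $X$, the cellular chain groups $C_p(X;\mathbb{Z})$ carry the $\ell^1$ norm with respect to the basis of $p$-cells: $\|\sum a_i\sigma_i\|=\sum|a_i|$. For an exact 1-cycle $z\in\partial C_2(X;\mathbb{Z})$ set $\mathsf{fill}_1(z;\mathbb{Z})=\inf\{\|A\| : A\in C_2(X;\mathbb{Z}),\ \partial A=z\}$. Define $$\rho_1(X;\mathbb{Z})=\inf_{0\ne z\in\partial C_2(X;\mathbb{Z})}\frac{\|z\|}{\mathsf{fill}_1(z;\mathbb{Z})}$$ (with the usual conventions $\inf\emptyset=+\infty$, $0\cdot\infty=0$). Since $X$ is a 2-complex, $H_2(X;\mathbb{Z})$ is identified with the group of 2-cycles $\ker(\partial_2)\subset C_2(X;\mathbb{Z})$.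 If $H_2(X;\mathbb{Z})$ has rank $b>0$, $$\xi_2(X;\mathbb{Z})=\inf\Bigl\{\max_{1\le j\le b}\|S_j\| : S_1,\dots,S_b\in H_2(X;\mathbb{Z})\text{ generate a rank } b\text{ subgroup of }H_2(X;\mathbb{Z})\Bigr\},$$ and $\xi_2(X;\mathbb{Z})=0$ if $H_2(X;\mathbb{Z})=0$. *)

(* Defs.v *)
From HB Require Import structures.
From Stdlib Require Import Relation_Operators.
From mathcomp Require Import all_boot all_order all_algebra generic_quotient.
From mathcomp Require Import finmap freeg.
From mathcomp Require Import boolp classical_sets functions cardinality reals.
From mathcomp Require Import ereal sequences topology normedtype exp measure.

Set Implicit Arguments.
Unset Strict Implicit.
Unset Printing Implicit Defensive.

Import Order.TTheory GRing.Theory Num.Theory.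
Import numFieldNormedType.Exports.

Local Open Scope quotient_scope.
Local Open Scope classical_set_scope.
Local Open Scope ring_scope.

Section Groups.
Context (G : groupType).
Implicit Types (H N : set G) (S : {fset G}).

Definition is_subgroup H : Prop :=
  [/\ H 1%g,
      forall x y, H x -> H y -> H (x * y)%g
    & forall x, H x -> H (x^-1)%g].

Record subgroup := Subgroup {
  subgroup_set :> set G;
  subgroupP : is_subgroup subgroup_set }.

Definition normal_set H : Prop := forall x g : G, H x -> H (x ^ g)%g.

Definition lcoset H (g : G) : set G := [set (g * h)%g | h in H].

Definition cosets H : set (set G) := range (lcoset H).

Definition finite_index H : Prop := finite_set (cosets H).

(* Only meaningful when H has finite index (it is 0 otherwise). *)
Definition coset_index H : nat := #|` fset_set (cosets H)|.

Definition gen (A : set G) : set G := smallest is_subgroup A.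

Definition derived H : set G :=
  gen [set c : G | exists x y, [/\ H x, H y & c = [~ x, y]%g]].

(* H / [H, H], as a set of cosets; [counting (abelianization H)] is its
   cardinality, which is +oo if it is infinite. *)
Definition abelianization H : set (set G) := lcoset (derived H) @` H.

(* Right translation of a coset; for N normal, (g N) s = (g s) N. *)
Definition rtrans (A : set G) (s : G) : set G := [set (a * s)%g | a in A].

(* The Cayley graph of G / N with respect to the image of S, as a simple
   undirected graph. *)
Definition cayley_adj N S : rel (fset_set (cosets N)) := fun A B =>
  (A != B) &&
  [exists s : S, (rtrans (val A) (val s) == val B)
                 || (rtrans (val B) (val s) == val A)].

End Groups.

Section SpectralGap.
Context (R : realType).

Definition laplacian (T : finType) (e : rel T) : 'M[R]_#|T| :=
  \matrix_(i, j) ((i == j)%:R * (#|[pred y | e (enum_val i) y]|)%:R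
                  - (e (enum_val i) (enum_val j))%:R).

(* The second smallest eigenvalue of the Laplacian, counted with multiplicity,
   is at least eps. *)
Definition spectral_gap (T : finType) (e : rel T) (eps : R) : Prop :=
  (\rank (eigenspace (laplacian e) 0) <= 1)%N /\
  (forall a : R, eigenvalue (laplacian e) a -> a != 0 -> eps <= a).

Definition property_tau (G : groupType) : Prop :=
  exists S : {fset G}, gen [set` S] = [set: G] /\
  exists2 eps : R, 0 < eps &
    forall N : subgroup G, normal_set N -> finite_index N ->
      spectral_gap (@cayley_adj G N S) eps.

End SpectralGap.

Section Walks.
Context (V E : choiceType) (src tgt : E -> V).

(* A letter (e, true) is the edge e traversed from src e to tgt e, and
   (e, false) is e traversed backwards. *)
Definition lsrc (a : E * bool) : V := if a.2 then src a.1 else tgt a.1.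
Definition ltgt (a : E * bool) : V := if a.2 then tgt a.1 else src a.1.
Definition linv (a : E * bool) : E * bool := (a.1, ~~ a.2).

Fixpoint walk (x : V) (p : seq (E * bool)) (y : V) : bool :=
  if p is a :: p' then (lsrc a == x) && walk (ltgt a) p' y else x == y.

Definition walk_inv (p : seq (E * bool)) : seq (E * bool) := rev (map linv p).

Lemma walk_cat x y z p q : walk x p y -> walk y q z -> walk x (p ++ q) z.
Proof.
elim: p x => [|a p IHp] x /=; first by move=> /eqP ->.
by move=> /andP[-> /IHp]; apply.
Qed.

Lemma walk_catE x z p q :
  walk x (p ++ q) z -> exists2 y, walk x p y & walk y q z.
Proof.
elim: p x => [|a p IHp] x /=; first by exists x.
by move=> /andP[-> /IHp[y wp wq]]; exists y.
Qed.

Lemma lsrc_inv a : lsrc (linv a) = ltgt a.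
Proof. by case: a => e []. Qed.

Lemma ltgt_inv a : ltgt (linv a) = lsrc a.
Proof. by case: a => e []. Qed.

Lemma linvK : involutive linv.
Proof. by case=> e []. Qed.

Lemma walk_rev x y p : walk x p y -> walk y (walk_inv p) x.
Proof.
rewrite /walk_inv; elim: p x => [|a p IHp] x /=; first by rewrite eq_sym.
move=> /andP[/eqP <- /IHp wp]; rewrite rev_cons -cats1.
by apply: walk_cat wp _; rewrite /= lsrc_inv ltgt_inv !eqxx.
Qed.

End Walks.

(* Vertices, edges (each with a chosen orientation) and polygonal faces; the
   face f is attached along the closed edge path [bnd f], read from [base f].
   Cells are allowed to be infinite in number, as in a universal cover. *)
Record complex := Complex {
  vert : choiceType;
  edge : choiceType;
  face : choiceType;
  src : edge -> vert;
  tgt : edge -> vert;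
  base : face -> vert;
  bnd : face -> seq (edge * bool);
  bnd_size : forall f, (3 <= size (bnd f))%N;
  bnd_walk : forall f, walk src tgt (base f) (bnd f) (base f) }.

Notation cwalk X := (walk (@src X) (@tgt X)).

Definition finite_complex (X : complex) : Prop :=
  [/\ finite_set [set: vert X], finite_set [set: edge X]
    & finite_set [set: face X]].

Definition connected_complex (X : complex) : Prop :=
  forall x y : vert X, exists p, cwalk X x p y.

Section Homotopy.
Context (X : complex).
Local Notation letter := (edge X * bool)%type.
Local Notation walk := (cwalk X).

(* Deletion of a backtrack, or of the boundary of a face. *)
Inductive hstep : seq letter -> seq letter -> Prop :=
| hstep_spur u a v : hstep (u ++ [:: a; linv a] ++ v) (u ++ v)
| hstep_face u f v : hstep (u ++ bnd f ++ v) (u ++ v).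

(* Homotopy relative to the endpoints of edge paths from x to y. *)
Definition homotopic (x y : vert X) : seq letter -> seq letter -> Prop :=
  clos_refl_sym_trans _
    (fun p q => [/\ walk x p y, walk x q y & hstep p q]).

Lemma homotopic_refl x y p : homotopic x y p p.
Proof. exact: rst_refl. Qed.

Lemma homotopic_sym x y p q : homotopic x y p q -> homotopic x y q p.
Proof. exact: rst_sym. Qed.

Lemma homotopic_trans x y q p r :
  homotopic x y p q -> homotopic x y q r -> homotopic x y p r.
Proof. exact: rst_trans. Qed.

Lemma homotopic_ctx w x y z u v p q : walk w u x -> walk y v z ->
  homotopic x y p q -> homotopic w z (u ++ p ++ v) (u ++ q ++ v).
Proof.
move=> wu wv; elim=> {p q} [p q [wp wq s]|p|p q _|p q r _ IH1 _ IH2].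
- apply: rst_step; split.
  + exact: walk_cat wu (walk_cat wp wv).
  + exact: walk_cat wu (walk_cat wq wv).
  + case: s => [u' a v'|u' f v'].
      have := hstep_spur (u ++ u') a (v' ++ v).
      by rewrite -!catA.
    have := hstep_face (u ++ u') f (v' ++ v).
    by rewrite -!catA.
- exact: homotopic_refl.
- exact: homotopic_sym.
- exact: homotopic_trans IH1 IH2.
Qed.

Lemma homotopic_cat x y z p p' q q' : walk x p' y -> walk y q z ->
  homotopic x y p p' -> homotopic y z q q' ->
  homotopic x z (p ++ q) (p' ++ q').
Proof.
move=> wp' wq hp hq; apply: (homotopic_trans (q := p' ++ q)).
  by apply: (homotopic_ctx (u := [::])) hp => //=.
have wn : walk z [::] z by rewrite /=.
by have := homotopic_ctx wp' wn hq; rewrite !cats0.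
Qed.

Lemma homotopic_mulV x y p : walk x p y -> homotopic x x (p ++ walk_inv p) [::].
Proof.
elim: p x => [|a p IHp] x /=; first by move=> _; apply: homotopic_refl.
move=> /andP[/eqP <- wp].
have -> : a :: p ++ walk_inv (a :: p) =
    [:: a] ++ (p ++ walk_inv p) ++ [:: linv a].
  by rewrite /walk_inv /= rev_cons -cats1 catA.
have wa : walk (lsrc (@src X) (@tgt X) a) [:: a] (ltgt (@src X) (@tgt X) a).
  by rewrite /= !eqxx.
have wa' : walk (ltgt (@src X) (@tgt X) a) [:: linv a]
    (lsrc (@src X) (@tgt X) a).
  by rewrite /= lsrc_inv ltgt_inv !eqxx.
apply: (homotopic_trans (q := [:: a] ++ [::] ++ [:: linv a])).
  exact: homotopic_ctx wa wa' (IHp _ wp).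
apply: rst_step; split.
- exact: (walk_cat wa).
- by rewrite /=.
- exact: (hstep_spur [::] a [::]).
Qed.

Lemma walk_invK : involutive (@walk_inv (edge X)).
Proof.
move=> p; rewrite /walk_inv map_rev revK -map_comp -[RHS]map_id.
by apply: eq_map => a /=; rewrite linvK.
Qed.

Lemma homotopic_Vmul x y p : walk x p y -> homotopic y y (walk_inv p ++ p) [::].
Proof. by move=> /walk_rev /homotopic_mulV; rewrite walk_invK. Qed.

Lemma homotopic_bnd x f y u v : walk x u (base f) -> walk (base f) v y ->
  homotopic x y (u ++ bnd f ++ v) (u ++ v).
Proof.
move=> wu wv; apply: rst_step; split; last exact: hstep_face.
- exact: walk_cat wu (walk_cat (bnd_walk f) wv).
- exact: walk_cat wu wv.
Qed.

End Homotopy.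

Section FundamentalGroup.
Context (X : complex) (x0 : vert X).
Local Notation letter := (edge X * bool)%type.

Definition loop := {p : seq letter | cwalk X x0 p x0}.

Definition loop_rel : rel loop :=
  fun p q => `[< homotopic x0 x0 (val p) (val q) >].

Lemma loop_rel_refl : reflexive loop_rel.
Proof. by move=> p; apply/asboolP/homotopic_refl. Qed.

Lemma loop_rel_sym : symmetric loop_rel.
Proof. by move=> p q; apply/asboolP/asboolP => /homotopic_sym. Qed.

Lemma loop_rel_trans : transitive loop_rel.
Proof.
by move=> q p r /asboolP pq /asboolP qr; apply/asboolP/(homotopic_trans pq qr).
Qed.

Canonical loop_equiv :=
  EquivRel loop_rel loop_rel_refl loop_rel_sym loop_rel_trans.

Definition pi1 := {eq_quot loop_rel}.

HB.instance Definition _ := Choice.on pi1.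
HB.instance Definition _ := Quotient.on pi1.
HB.instance Definition _ : EqQuotient _ loop_rel pi1 := EqQuotient.on pi1.

Definition loop1 : loop := exist _ [::] (eqxx x0).
Definition loop_mul (p q : loop) : loop :=
  exist _ (val p ++ val q) (walk_cat (valP p) (valP q)).
Definition loop_inv (p : loop) : loop :=
  exist _ (walk_inv (val p)) (walk_rev (valP p)).

Definition pi1_one : pi1 := \pi_pi1 loop1.
Definition pi1_mul (g h : pi1) : pi1 := \pi_pi1 (loop_mul (repr g) (repr h)).
Definition pi1_inv (g : pi1) : pi1 := \pi_pi1 (loop_inv (repr g)).

Lemma pi1_piP (p q : loop) :
  homotopic x0 x0 (val p) (val q) <-> \pi_pi1 p = \pi_pi1 q.
Proof.
split; first by move=> h; apply/eqmodP/asboolP.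
by move=> /eqmodP/asboolP.
Qed.

Lemma pi1_repr (p : loop) : homotopic x0 x0 (val (repr (\pi_pi1 p))) (val p).
Proof. by apply/pi1_piP; rewrite reprK. Qed.

Lemma pi1_mul_pi p q : pi1_mul (\pi_pi1 p) (\pi_pi1 q) = \pi_pi1 (loop_mul p q).
Proof.
apply/pi1_piP => /=.
have w := valP (repr (\pi_pi1 q)).
have := homotopic_cat (valP p) w (pi1_repr p) (pi1_repr q).
exact.
Qed.

Lemma pi1_mulA : associative pi1_mul.
Proof.
move=> g h k; rewrite -[g]reprK -[h]reprK -[k]reprK.
rewrite (pi1_mul_pi (repr h)) (pi1_mul_pi _ (loop_mul _ _)).
rewrite (pi1_mul_pi (repr g) (repr h)) (pi1_mul_pi (loop_mul _ _)).
by apply/pi1_piP; rewrite /= catA; apply: homotopic_refl.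
Qed.

Lemma pi1_mul1 : left_id pi1_one pi1_mul.
Proof.
move=> g; rewrite -[g]reprK pi1_mul_pi.
by apply/pi1_piP; apply: homotopic_refl.
Qed.

Lemma pi1_mulr1 : right_id pi1_one pi1_mul.
Proof.
move=> g; rewrite -[g]reprK pi1_mul_pi.
by apply/pi1_piP; rewrite /= cats0; apply: homotopic_refl.
Qed.

Lemma pi1_mulV : left_inverse pi1_one pi1_inv pi1_mul.
Proof.
move=> g; rewrite -[X in pi1_mul _ X]reprK pi1_mul_pi.
by apply/pi1_piP; apply: homotopic_Vmul (valP (repr g)).
Qed.

Lemma pi1_mulrV : right_inverse pi1_one pi1_inv pi1_mul.
Proof.
move=> g; rewrite -[X in pi1_mul X _]reprK pi1_mul_pi.
by apply/pi1_piP; apply: homotopic_mulV (valP (repr g)).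
Qed.

HB.instance Definition _ :=
  isGroup.Build pi1 pi1_mulA pi1_mul1 pi1_mulr1 pi1_mulV pi1_mulrV.

End FundamentalGroup.

Section UniversalCoverVertices.
Context (X : complex) (x0 : vert X).
Local Notation letter := (edge X * bool)%type.
Local Notation pi1 := (pi1 x0).

(* Edge paths from x0, each paired with its endpoint. *)
Definition upath := {yp : vert X * seq letter | cwalk X x0 yp.2 yp.1}.

Definition Upath y p (w : cwalk X x0 p y) : upath :=
  exist (fun yp => cwalk X x0 yp.2 yp.1 : Prop) (y, p) w.

Definition upath_rel : rel upath := fun p q =>
  ((val p).1 == (val q).1) &&
  `[< homotopic x0 (val p).1 (val p).2 (val q).2 >].

Lemma upath_rel_refl : reflexive upath_rel.
Proof. by move=> p; rewrite /upath_rel eqxx; apply/asboolP/homotopic_refl. Qed.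

Lemma upath_rel_sym : symmetric upath_rel.
Proof.
move=> p q; rewrite /upath_rel eq_sym; case: eqP => //= ->.
by apply/asboolP/asboolP => /homotopic_sym.
Qed.

Lemma upath_rel_trans : transitive upath_rel.
Proof.
move=> q p r /andP[/eqP epq /asboolP pq] /andP[/eqP eqr /asboolP qr].
rewrite /upath_rel epq eqr eqxx /=; apply/asboolP.
by rewrite -eqr; apply: (homotopic_trans (q := (val q).2)) qr; rewrite -epq.
Qed.

Canonical upath_equiv :=
  EquivRel upath_rel upath_rel_refl upath_rel_sym upath_rel_trans.

Definition uvert := {eq_quot upath_rel}.

HB.instance Definition _ := Choice.on uvert.
HB.instance Definition _ := Quotient.on uvert.
HB.instance Definition _ : EqQuotient _ upath_rel uvert := EqQuotient.on uvert.

Definition uproj (v : uvert) : vert X := (val (repr v)).1.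

(* The endpoint of the lift at v of the letter a; it is v itself if a does not
   start at uproj v. *)
Definition extend (v : uvert) (a : letter) : uvert :=
  \pi_uvert (insubd (repr v)
    (ltgt (@src X) (@tgt X) a, rcons (val (repr v)).2 a)).

Definition deckv (g : pi1) (v : uvert) : uvert :=
  \pi_uvert (Upath (walk_cat (valP (repr g)) (valP (repr v)))).

Lemma uvert_piP (p q : upath) :
  (val p).1 = (val q).1 /\ homotopic x0 (val p).1 (val p).2 (val q).2
  <-> \pi_uvert p = \pi_uvert q.
Proof.
split; first by move=> [e h]; apply/eqmodP/andP; split; [exact/eqP|exact/asboolP].
by move=> /eqmodP/andP[/eqP e /asboolP h].
Qed.

Lemma uvert_repr (p : upath) :
  (val (repr (\pi_uvert p))).1 = (val p).1 /\
  homotopic x0 (val p).1 (val (repr (\pi_uvert p))).2 (val p).2.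
Proof.
have [e h] : (val (repr (\pi_uvert p))).1 = (val p).1 /\
    homotopic x0 (val (repr (\pi_uvert p))).1 (val (repr (\pi_uvert p))).2
      (val p).2 by apply/uvert_piP; rewrite reprK.
by split=> //; rewrite -e.
Qed.

Lemma uproj_pi (p : upath) : uproj (\pi_uvert p) = (val p).1.
Proof. exact: (uvert_repr p).1. Qed.

Lemma extend_pi (p : upath) a (w : cwalk X x0 (rcons (val p).2 a)
    (ltgt (@src X) (@tgt X) a)) : lsrc (@src X) (@tgt X) a = (val p).1 ->
  extend (\pi_uvert p) a = \pi_uvert (Upath w).
Proof.
move=> ea; have [e h] := uvert_repr p.
have wa : cwalk X (val p).1 [:: a] (ltgt (@src X) (@tgt X) a).
  by rewrite /= ea !eqxx.
have wr : cwalk X x0 (rcons (val (repr (\pi_uvert p))).2 a)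
    (ltgt (@src X) (@tgt X) a).
  have wr := valP (repr (\pi_uvert p)); rewrite e in wr.
  by rewrite -cats1; apply: walk_cat wr wa.
apply/uvert_piP; rewrite !val_insubd /= wr /=; split=> //.
rewrite -!cats1; have wp := valP p.
by have := homotopic_cat wp wa h (homotopic_refl _ _ _); apply.
Qed.

Lemma extend_invalid v a : lsrc (@src X) (@tgt X) a != uproj v -> extend v a = v.
Proof.
move=> ne; rewrite -[RHS]reprK; apply/uvert_piP; rewrite !val_insubd /=.
case: ifP => [|_]; last by split=> //; apply: homotopic_refl.
rewrite -cats1 => /walk_catE[y wy] /= /andP[/eqP ay _]; case/negP: ne.
rewrite ay /uproj; apply/eqP.
have walk_end (p : seq letter) x y1 y2 :
    cwalk X x p y1 -> cwalk X x p y2 -> y1 = y2.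
  elim: p x => [|b p IHp] x /=; first by move=> /eqP <- /eqP.
  by move=> /andP[_ w1] /andP[_ w2]; apply: IHp w1 w2.
exact: walk_end wy (valP (repr v)).
Qed.

Lemma uproj_extend v a : lsrc (@src X) (@tgt X) a = uproj v ->
  uproj (extend v a) = ltgt (@src X) (@tgt X) a.
Proof.
move=> ea; rewrite -[v]reprK.
have w : cwalk X x0 (rcons (val (repr v)).2 a) (ltgt (@src X) (@tgt X) a).
  rewrite -cats1; apply: walk_cat (valP (repr v)) _.
  by rewrite /= ea !eqxx.
by rewrite (extend_pi w) // uproj_pi.
Qed.

Lemma extendK v a : lsrc (@src X) (@tgt X) a = uproj v ->
  extend (extend v a) (linv a) = v.
Proof.
move=> ea; rewrite -[v]reprK.
have wa : cwalk X x0 (rcons (val (repr v)).2 a) (ltgt (@src X) (@tgt X) a).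
  rewrite -cats1; apply: walk_cat (valP (repr v)) _.
  by rewrite /= ea !eqxx.
have wb : cwalk X x0 (rcons (rcons (val (repr v)).2 a) (linv a))
    (ltgt (@src X) (@tgt X) (linv a)).
  rewrite -cats1; apply: walk_cat wa _.
  by rewrite /= lsrc_inv !eqxx.
rewrite (extend_pi wa) // (extend_pi (p := Upath wa) wb) ?lsrc_inv //.
apply/uvert_piP => /=; rewrite ltgt_inv ea; split=> //.
apply: rst_step; split.
- by move: wb; rewrite ltgt_inv ea.
- exact: (valP (repr v)).
- by have := hstep_spur (val (repr v)).2 a [::]; rewrite /= cats0 -!cats1 -catA.
Qed.

Lemma extend_walk (p : upath) q y (w : cwalk X (val p).1 q y) :
  foldl extend (\pi_uvert p) q =
  \pi_uvert (Upath (walk_cat (valP p) w)).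
Proof.
elim: q p w => [|a q IHq] p w.
  apply/uvert_piP; rewrite /= cats0; split; last exact: homotopic_refl.
  by move: (w) => /= /eqP.
have /= /andP[/eqP ea wq] := w.
have wa : cwalk X x0 (rcons (val p).2 a) (ltgt (@src X) (@tgt X) a).
  rewrite -cats1; apply: walk_cat (valP p) _.
  by rewrite /= ea !eqxx.
rewrite (extend_pi wa) // IHq; apply/uvert_piP => /=; split=> //.
by rewrite cat_rcons; apply: homotopic_refl.
Qed.

Lemma extend_bnd v f : uproj v = base f -> foldl extend v (bnd f) = v.
Proof.
move=> ev; have w : cwalk X (val (repr v)).1 (bnd f) (val (repr v)).1.
  by move: ev; rewrite /uproj => ->; apply: bnd_walk.
rewrite -[v in LHS]reprK (extend_walk w) -[RHS]reprK.
apply/uvert_piP; split=> //=.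
have wv := valP (repr v).
have wn : cwalk X (base f) [::] (val (repr v)).1 by rewrite /= -ev /uproj.
have := homotopic_bnd (u := (val (repr v)).2) _ wn.
by rewrite !cats0; apply; rewrite -ev.
Qed.

Lemma deckv_pi (g : loop x0) (p : upath) :
  deckv (\pi_(pi1) g) (\pi_uvert p) =
  \pi_uvert (Upath (walk_cat (valP g) (valP p))).
Proof.
have [e h] := uvert_repr p.
apply/uvert_piP; rewrite /= e; split=> //.
have wg := valP g; have wr := valP (repr (\pi_uvert p)); rewrite e in wr.
by have := homotopic_cat wg wr (pi1_repr g) h; apply.
Qed.

Lemma uproj_deck g v : uproj (deckv g v) = uproj v.
Proof. by rewrite -[g]reprK -[v]reprK deckv_pi !uproj_pi. Qed.

Lemma deckv1 v : deckv 1%g v = v.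
Proof.
rewrite -[v]reprK deckv_pi; apply/uvert_piP; split=> //.
exact: homotopic_refl.
Qed.

Lemma deckvM g h v : deckv (g * h)%g v = deckv g (deckv h v).
Proof.
rewrite -[g]reprK -[h]reprK -[v]reprK [(_ * _)%g]pi1_mul_pi.
rewrite (deckv_pi (repr h)) (deckv_pi _ (Upath _)) (deckv_pi (loop_mul _ _)).
by apply/uvert_piP; rewrite /= catA; split=> //; apply: homotopic_refl.
Qed.

Lemma deckv_extend g v a : deckv g (extend v a) = extend (deckv g v) a.
Proof.
case: (altP (lsrc (@src X) (@tgt X) a =P uproj v)) => [ea|ne]; last first.
  by rewrite !extend_invalid ?uproj_deck.
rewrite -[g]reprK -[v]reprK.
have wa : cwalk X x0 (rcons (val (repr v)).2 a) (ltgt (@src X) (@tgt X) a).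
  rewrite -cats1; apply: walk_cat (valP (repr v)) _.
  by rewrite /= ea !eqxx.
have wb : cwalk X x0 (rcons (val (repr g) ++ (val (repr v)).2) a)
    (ltgt (@src X) (@tgt X) a).
  by rewrite -cats1 -catA cats1; apply: walk_cat (valP (repr g)) wa.
rewrite (extend_pi wa) // !deckv_pi.
rewrite (extend_pi (p := Upath (walk_cat (valP (repr g)) (valP (repr v)))) wb) //.
apply/uvert_piP => /=; split=> //.
by rewrite rcons_cat; apply: homotopic_refl.
Qed.

End UniversalCoverVertices.

Section UniversalCover.
Context (X : complex) (x0 : vert X).
Local Notation letter := (edge X * bool)%type.
Local Notation pi1 := (pi1 x0).
Local Notation uvert := (uvert x0).

(* The lift of an edge (face) is determined by the lift of its source (base
   vertex). *)
Definition uedge := {ve : uvert * edge X | uproj ve.1 == src ve.2}.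
Definition uface := {vf : uvert * face X | uproj vf.1 == base vf.2}.

HB.instance Definition _ := Choice.on uedge.
HB.instance Definition _ := Choice.on uface.

Definition usrc (e : uedge) : uvert := (val e).1.
Definition utgt (e : uedge) : uvert := extend (val e).1 ((val e).2, true).

(* The edge path starting at v which lies over p; the case [None] does not occur
   when p is an edge path from uproj v. *)
Fixpoint ulift (v : uvert) (p : seq letter) : seq (uedge * bool) :=
  if p is a :: p' then
    let q := ulift (extend v a) p' in
    if insub (if a.2 then v else extend v a, a.1) is Some e
    then (e, a.2) :: q else q
  else [::].

Lemma ulift_cons v a p : lsrc (@src X) (@tgt X) a = uproj v ->
  exists2 e : uedge, val e = (if a.2 then v else extend v a, a.1) &
    ulift v (a :: p) = (e, a.2) :: ulift (extend v a) p.
Proof.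
move=> ea /=; case: insubP => [e _ ve|]; first by exists e.
case/eqP => /=; have := uproj_extend ea.
by case: a ea => e []; rewrite /lsrc /ltgt /=.
Qed.

Lemma size_ulift v p y : cwalk X (uproj v) p y -> size (ulift v p) = size p.
Proof.
elim: p v => [//|a p IHp] v /andP[/eqP ea wp].
have [e _ ->] := ulift_cons p ea.
by rewrite /= IHp // uproj_extend.
Qed.

Lemma walk_ulift v p y : cwalk X (uproj v) p y ->
  walk usrc utgt v (ulift v p) (foldl (@extend X x0) v p).
Proof.
elim: p v => [|a p IHp] v; first by rewrite /= eqxx.
move=> /andP[/eqP ea wp]; have [e ve ->] := ulift_cons p ea.
have [sa ta] : lsrc usrc utgt (e, a.2) = v /\
    ltgt usrc utgt (e, a.2) = extend v a.
  rewrite /lsrc /ltgt /usrc /utgt ve; case: a ea {wp ve} => b [] //= ea.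
  by have := extendK ea.
rewrite [walk _ _ _ _ _]/= sa ta eqxx; apply: IHp.
by rewrite uproj_extend.
Qed.

Definition ubase (f : uface) : uvert := (val f).1.
Definition ubnd (f : uface) : seq (uedge * bool) :=
  ulift (val f).1 (bnd (val f).2).

Lemma ubnd_size f : (3 <= size (ubnd f))%N.
Proof.
rewrite (@size_ulift _ _ (base (val f).2)) ?bnd_size //.
by rewrite (eqP (valP f)); apply: bnd_walk.
Qed.

Lemma ubnd_walk f : walk usrc utgt (ubase f) (ubnd f) (ubase f).
Proof.
have w : cwalk X (uproj (val f).1) (bnd (val f).2) (base (val f).2).
  by rewrite (eqP (valP f)); apply: bnd_walk.
by have := walk_ulift w; rewrite extend_bnd //; apply/eqP/(valP f).
Qed.

Definition universal_cover : complex := Complex ubnd_size ubnd_walk.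

End UniversalCover.

(* Edges carry a chosen orientation, which such an action preserves. *)
Record cell_action (G : groupType) (X : complex) := CellAction {
  actv : G -> vert X -> vert X;
  acte : G -> edge X -> edge X;
  actf : G -> face X -> face X;
  actv1 : forall v, actv 1%g v = v;
  acte1 : forall e, acte 1%g e = e;
  actf1 : forall f, actf 1%g f = f;
  actvM : forall g h v, actv (g * h)%g v = actv g (actv h v);
  acteM : forall g h e, acte (g * h)%g e = acte g (acte h e);
  actfM : forall g h f, actf (g * h)%g f = actf g (actf h f);
  act_src : forall g e, src (acte g e) = actv g (src e);
  act_tgt : forall g e, tgt (acte g e) = actv g (tgt e);
  act_base : forall g f, base (actf g f) = actv g (base f);
  act_bnd : forall g f, bnd (actf g f) = [seq (acte g a.1, a.2) | a <- bnd f] }.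

Section OrbitRel.
Context (G : groupType) (T : choiceType) (act : G -> T -> T).
Hypothesis act1 : forall x, act 1%g x = x.
Hypothesis actM : forall g h x, act (g * h)%g x = act g (act h x).
Context (H : subgroup G).

Definition orbit_rel : rel T := fun x y =>
  `[< exists2 g, (H : set G) g & act g x = y >].

Lemma orbit_rel_refl : reflexive orbit_rel.
Proof. by move=> x; apply/asboolP; exists 1%g => //; case: (subgroupP H). Qed.

Lemma orbit_rel_sym : symmetric orbit_rel.
Proof.
have [_ _ HV] := subgroupP H.
suff sub x y : orbit_rel x y -> orbit_rel y x by move=> x y; apply/idP/idP => /sub.
move=> /asboolP[g Hg <-]; apply/asboolP; exists (g^-1)%g; first exact: HV.
by rewrite -actM mulVg act1.
Qed.

Lemma orbit_rel_trans : transitive orbit_rel.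
Proof.
have [_ HM _] := subgroupP H.
move=> y x z /asboolP[g Hg <-] /asboolP[h Hh <-].
by apply/asboolP; exists (h * g)%g; [exact: HM|rewrite actM].
Qed.

End OrbitRel.

Section QuotientComplex.
Context (G : groupType) (X : complex) (A : cell_action G X) (H : subgroup G).

Definition qvert_rel : rel (vert X) := orbit_rel (actv A) H.
Definition qedge_rel : rel (edge X) := orbit_rel (acte A) H.
Definition qface_rel : rel (face X) := orbit_rel (actf A) H.

Canonical qvert_equiv := EquivRel qvert_rel
  (orbit_rel_refl (actv1 A) H) (orbit_rel_sym (actv1 A) (actvM A) H)
  (orbit_rel_trans (actvM A) (H := H)).
Canonical qedge_equiv := EquivRel qedge_rel
  (orbit_rel_refl (acte1 A) H) (orbit_rel_sym (acte1 A) (acteM A) H)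
  (orbit_rel_trans (acteM A) (H := H)).
Canonical qface_equiv := EquivRel qface_rel
  (orbit_rel_refl (actf1 A) H) (orbit_rel_sym (actf1 A) (actfM A) H)
  (orbit_rel_trans (actfM A) (H := H)).

Definition qvert := {eq_quot qvert_rel}.
Definition qedge := {eq_quot qedge_rel}.
Definition qface := {eq_quot qface_rel}.

HB.instance Definition _ := Choice.on qvert.
HB.instance Definition _ := Quotient.on qvert.
HB.instance Definition _ : EqQuotient _ qvert_rel qvert := EqQuotient.on qvert.
HB.instance Definition _ := Choice.on qedge.
HB.instance Definition _ := Quotient.on qedge.
HB.instance Definition _ : EqQuotient _ qedge_rel qedge := EqQuotient.on qedge.
HB.instance Definition _ := Choice.on qface.
HB.instance Definition _ := Quotient.on qface.
HB.instance Definition _ : EqQuotient _ qface_rel qface := EqQuotient.on qface.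

Definition qsrc (e : qedge) : qvert := \pi_qvert (src (repr e)).
Definition qtgt (e : qedge) : qvert := \pi_qvert (tgt (repr e)).
Definition qbase (f : qface) : qvert := \pi_qvert (base (repr f)).
Definition qbnd (f : qface) : seq (qedge * bool) :=
  [seq (\pi_qedge a.1, a.2) | a <- bnd (repr f)].

Lemma qsrc_pi e : qsrc (\pi_qedge e) = \pi_qvert (src e).
Proof.
have /eqmodP/asboolP[g Hg eg] : \pi_qedge (repr (\pi_qedge e)) = \pi_qedge e.
  by rewrite reprK.
by apply/eqmodP/asboolP; exists g => //; rewrite -act_src eg.
Qed.

Lemma qtgt_pi e : qtgt (\pi_qedge e) = \pi_qvert (tgt e).
Proof.
have /eqmodP/asboolP[g Hg eg] : \pi_qedge (repr (\pi_qedge e)) = \pi_qedge e.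
  by rewrite reprK.
by apply/eqmodP/asboolP; exists g => //; rewrite -act_tgt eg.
Qed.

Lemma qwalk x p y : cwalk X x p y ->
  walk qsrc qtgt (\pi_qvert x) [seq (\pi_qedge a.1, a.2) | a <- p] (\pi_qvert y).
Proof.
elim: p x => [|[e b] p IHp] x /=; first by move=> /eqP ->.
move=> /andP[/eqP <- /IHp].
rewrite /lsrc /ltgt /=; case: b => /=; rewrite qsrc_pi qtgt_pi eqxx //.
Qed.

Lemma qbnd_size f : (3 <= size (qbnd f))%N.
Proof. by rewrite size_map bnd_size. Qed.

Lemma qbnd_walk f : walk qsrc qtgt (qbase f) (qbnd f) (qbase f).
Proof. exact/qwalk/bnd_walk. Qed.

Definition quotient_complex : complex := Complex qbnd_size qbnd_walk.

End QuotientComplex.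

Section DeckAction.
Context (X : complex) (x0 : vert X).
Local Notation letter := (edge X * bool)%type.
Local Notation pi1 := (pi1 x0).
Local Notation uvert := (uvert x0).
Local Notation uedge := (uedge x0).
Local Notation uface := (uface x0).

Lemma decke_subproof (g : pi1) (e : uedge) :
  uproj (deckv g (val e).1, (val e).2).1 == src (val e).2.
Proof. by rewrite uproj_deck (valP e). Qed.

Lemma deckf_subproof (g : pi1) (f : uface) :
  uproj (deckv g (val f).1, (val f).2).1 == base (val f).2.
Proof. by rewrite uproj_deck (valP f). Qed.

Definition decke (g : pi1) (e : uedge) : uedge :=
  exist _ (deckv g (val e).1, (val e).2) (decke_subproof g e).

Definition deckf (g : pi1) (f : uface) : uface :=
  exist _ (deckv g (val f).1, (val f).2) (deckf_subproof g f).

Lemma decke1 e : decke 1%g e = e.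
Proof. by apply: val_inj; rewrite /= deckv1 -surjective_pairing. Qed.

Lemma deckf1 f : deckf 1%g f = f.
Proof. by apply: val_inj; rewrite /= deckv1 -surjective_pairing. Qed.

Lemma deckeM g h e : decke (g * h)%g e = decke g (decke h e).
Proof. by apply: val_inj; rewrite /= deckvM. Qed.

Lemma deckfM g h f : deckf (g * h)%g f = deckf g (deckf h f).
Proof. by apply: val_inj; rewrite /= deckvM. Qed.

Lemma deck_tgt g e : utgt (decke g e) = deckv g (utgt e).
Proof. by rewrite /utgt /= deckv_extend. Qed.

Lemma deck_ulift g v p y : cwalk X (uproj v) p y ->
  ulift (deckv g v) p = [seq (decke g a.1, a.2) | a <- ulift v p].
Proof.
elim: p v => [//|a p IHp] v /andP[/eqP ea wp].
have [e ve ->] := ulift_cons p ea.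
have [e' ve' ->] : exists2 e' : uedge,
    val e' = (if a.2 then deckv g v else extend (deckv g v) a, a.1) &
    ulift (deckv g v) (a :: p) = (e', a.2) :: ulift (extend (deckv g v) a) p.
  by apply: ulift_cons; rewrite uproj_deck.
rewrite /= -deckv_extend IHp ?uproj_extend //; congr ((_, _) :: _).
by apply: val_inj; rewrite ve' /= ve /= -deckv_extend; case: a.2.
Qed.

Lemma deck_bnd g f : ubnd (deckf g f) = [seq (decke g a.1, a.2) | a <- ubnd f].
Proof.
apply: (@deck_ulift _ _ _ (base (val f).2)).
by rewrite (eqP (valP f)); apply: bnd_walk.
Qed.

(* The class of a loop acts on classes of edge paths from x0 by
   precomposition. *)
Definition deck_action : cell_action pi1 (universal_cover x0) :=
  @CellAction pi1 (universal_cover x0) (@deckv X x0) decke deckf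
    (@deckv1 X x0) decke1 deckf1 (@deckvM X x0) deckeM deckfM
    (fun _ _ => erefl) deck_tgt (fun _ _ => erefl) deck_bnd.

Definition cover_of (H : subgroup pi1) : complex :=
  quotient_complex deck_action H.

End DeckAction.

Arguments cover_of {X} x0 H.

Section Chains.
Context (X : complex).

Definition chain1 := {freeg (edge X) / int}.
Definition chain2 := {freeg (face X) / int}.

Definition boundary_face (f : face X) : chain1 :=
  \sum_(a <- bnd f) << (-1) ^+ (~~ a.2) *g a.1 >>.

Definition boundary2 (A : chain2) : chain1 := fglift boundary_face A.

Definition H2 : set chain2 := [set A | boundary2 A = 0].

End Chains.

Arguments H2 : clear implicits.

Definition l1norm (K : choiceType) (c : {freeg K / int}) : int :=
  \sum_(k <- dom c) `|coeff k c|.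

Section Rank.
Context (V : zmodType).

Definition zindep (n : nat) (S : 'I_n -> V) : Prop :=
  forall c : 'I_n -> int, \sum_j S j *~ c j = 0 -> forall j, c j = 0.

Definition zspan (n : nat) (S : 'I_n -> V) : set V :=
  [set v | exists c : 'I_n -> int, v = \sum_j S j *~ c j].

(* The abelian group A has rank n. *)
Definition has_rank (A : set V) (n : nat) : Prop :=
  (exists2 S : 'I_n -> V, (forall j, A (S j)) & zindep S) /\
  (forall m (S : 'I_m -> V), (forall j, A (S j)) -> zindep S -> (m <= n)%N).

End Rank.

Section Invariants.
Context (R : realType) (X : complex).

Definition fill1 (z : chain1 X) : R :=
  inf [set (l1norm A)%:~R | A in [set A : chain2 X | boundary2 A = z]].

Definition rho1 : \bar R :=
  ereal_inf [set ((l1norm z)%:~R / fill1 z)%:E |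
              z in [set z | z != 0 /\ range (@boundary2 X) z]].

(* H2 X is torsion free, so that it has rank 0 only if it vanishes. *)
Definition xi2 : \bar R :=
  if `[< H2 X = [set 0] >] then 0%E else
  ereal_inf [set x : \bar R | exists b (S : 'I_b -> chain2 X),
    [/\ has_rank (H2 X) b, forall j, H2 X (S j), has_rank (zspan S) b
      & x = (\big[Num.max/0]_(j < b) (l1norm (S j))%:~R)%:E]].

End Invariants.

Definition residual_tower (R : realType) (G : groupType)
    (N : nat -> subgroup G) : Prop :=
  [/\ N 0%N = [set: G] :> set G,
      forall i, N i.+1 `<=` N i,
      forall i, normal_set (N i) /\ finite_index (N i),
      \bigcap_i N i = [set 1%g]
    & (fun i => (coset_index (N i))%:R : R) @ \oo --> +oo].

(* Main.v *)
From HB Require Import structures.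
From mathcomp Require Import spectral sesquilinear complex.
Require Import Defs.
From mathcomp Require Import all_boot all_order all_algebra.
From mathcomp Require Import generic_quotient ring_quotient finmap freeg.
From mathcomp Require Import boolp classical_sets functions cardinality reals.
From mathcomp Require Import ereal sequences topology normedtype exp measure.
From mathcomp Require Import zify ring lra.

(** Let [X] be the cover with group [N], [n] the index of [N], [T] the
    abelianization of [N].  If [T] is infinite the right-hand side is infinite.
    Otherwise the derived subgroup of [N] is normal of index at most [n * #|T|]
    in the fundamental group, so property (tau) bounds the diameter of its coset
    graph by [O(log (n * #|T|))].  Hence, with [L = O(1 + log n + log #|T|)], every
    vertex of [X] is reached from the base vertex by a walk of length at most [L],
    and every class [t] in the image of [N] in [H_1(X)] is represented by a loop
    [l t] of length at most [L].

    Each cycle [l (s + t) - l s - l t] is exact of norm at most [3 L], so it has a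
    filling [F s t] of norm at most [3 L / rho].  [F] is a 2-cocycle modulo 2-cycles
    of norm [O(L / rho)], and averaging over the finite group makes a multiple of it
    a coboundary.  Decomposing the boundary of each face into short loops based
    at the base vertex then shows that the 2-cycles of norm at most
    [1 + O(L / rho)] span a subgroup of finite index of [H_2(X)], which is the
    inequality [(xi - 1) * rho <= O(L)].

    For towers, [rho] is bounded by the largest face unless no nonzero 1-cycle is
    exact; in that case finiteness of [T] forces all closed walks of the cover to
    have chain zero, so its 1-skeleton is a tree, [N] is trivial, and the
    indices of the tower cannot tend to infinity. *)

Set Implicit Arguments.
Unset Strict Implicit.
Unset Printing Implicit Defensive.

Import Order.TTheory GRing.Theory Num.Theory.
Import numFieldNormedType.Exports.

Local Open Scope quotient_scope.
Local Open Scope classical_set_scope.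
Local Open Scope ring_scope.

(** * Diameter of a graph with a spectral gap *)

Section SpectralDecay.
Context (C : numClosedFieldType) (n : nat) (A : 'M[C]_n).
Local Open Scope sesquilinear_scope.
Hypothesis A_herm : A \is hermsymmx.
Hypothesis A_const : A *m const_mx 1 = 0 :> 'cV[C]_n.
Hypothesis A_ker : forall v : 'rV[C]_n, v *m A = 0 -> forall i j, v 0 i = v 0 j.
Context (s q : C).
Hypothesis q_ge0 : 0 <= q.
Hypothesis A_gap : forall a, a \is Num.real -> eigenvalue A a -> a != 0 ->
  `|1 - s * a| <= q.

(** In the orthonormal eigenbasis formed by the rows of [P], the matrix [1%:M - s *: A] acts by the
    scalars [1 - s * D 0 l]. Constant eigenvectors account for the entry [n%:R^-1]; the other terms
    are at most [q ^+ k] times [|P l i| |P l j|], and these products sum to at most 1 by the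
    arithmetic-geometric mean inequality, the columns of [P] being unit vectors. *)
Lemma spectral_decay k i j :
  `|((1%:M - s *: A : 'M_n) ^+ k) i j - n%:R^-1| <= q ^+ k.
Proof.
set P := spectralmx A; set D := spectral_diag A.
have PU : P \is unitarymx by apply: spectral_unitarymx.
have Pu : P \in unitmx by apply: spectral_unit.
have AE : A = invmx P *m diag_mx D *m P by apply/orthomx_spectralP/hermitian_normalmx.
have PA : P *m A = diag_mx D *m P by rewrite {1}AE !mulmxA mulmxV // mul1mx.
have rowPA l : row l P *m A = D 0 l *: row l P.
  by rewrite -row_mul PA mul_diag_mx; apply/rowP=> m; rewrite !mxE.
have rowP0 l : row l P != 0.
  apply/negP => /eqP rl0; have := Pu; rewrite unitmxE (expand_det_row _ l).
  rewrite big1 ?unitr0 // => m _.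
  by move/rowP: rl0 => /(_ m); rewrite !mxE => ->; rewrite mul0r.
have Dr l : D 0 l \is Num.real.
  by have /mxOverP := hermitian_spectral_diag_real A_herm; apply.
have eD l : eigenvalue A (D 0 l) by apply/eigenvalueP; exists (row l P).
pose B : 'M_n := 1%:M - s *: A.
have powE : B ^+ k = invmx P *m diag_mx (\row_l (1 - s * D 0 l) ^+ k) *m P.
  have PB : P *m B = diag_mx (\row_l (1 - s * D 0 l)) *m P.
    rewrite mulmxBr mulmx1 -scalemxAr PA !mul_diag_mx; apply/matrixP=> l m.
    by rewrite !mxE; ring.
  rewrite -[LHS]mul1mx -(mulVmx Pu) -!mulmxA; congr (_ *m _).
  elim: (k) => [|h IH].
    rewrite expr0 mulmx1 mul_diag_mx; apply/matrixP=> l m.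
    by rewrite !mxE expr0 mul1r.
  rewrite exprSr mulmxA IH -mulmxA PB !mul_diag_mx; apply/matrixP=> l m.
  by rewrite !mxE exprSr mulrA.
have colP m : \sum_l `|P l m| ^+ 2 = 1.
  have := mulVmx Pu; rewrite invmx_unitary // => /matrixP/(_ m m).
  rewrite !mxE eqxx => H; apply: etrans H; apply: eq_bigr => l _.
  by rewrite !mxE normCKC.
have i_n : (0 < n)%N by case: (n) i => [[]|].
(* These are the eigenbasis coordinates of the j-th basis vector minus its mean: they vanish on
   constant eigenvectors, and the mean is invisible to the others because their entries sum to 0. *)
pose y l := if D 0 l == 0 then 0 else P l j.
have PyE l : P l j - n%:R^-1 * \sum_m P l m = y l.
  rewrite /y; case: ifP => [/eqP Dl0|Dl0].
    have /A_ker H : row l P *m A = 0 by rewrite rowPA Dl0 scale0r.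
    rewrite (eq_bigr (fun=> P l j)); last first.
      by move=> m _; have := H m j; rewrite !mxE.
    rewrite sumr_const card_ord -[P l j *+ n]mulr_natl mulrA mulVf ?mul1r ?subrr //.
    by rewrite pnatr_eq0 -lt0n.
  have : row l P *m A *m const_mx 1 = 0 :> 'M_1 by rewrite -mulmxA A_const mulmx0.
  rewrite rowPA -scalemxAl => /matrixP/(_ 0 0); rewrite !mxE => /eqP.
  rewrite mulf_eq0 Dl0 /= => /eqP H.
  rewrite [X in _ * X](_ : _ = 0) ?mulr0 ?subr0 // -[RHS]H.
  by apply: eq_bigr => m _; rewrite !mxE mulr1.
have Bconst : B ^+ k *m const_mx 1 = const_mx 1 :> 'cV_n.
  elim: (k) => [|h IH]; first by rewrite expr0 mul1mx.
  by rewrite exprS -mulmxA IH mulmxBl mul1mx -scalemxAl A_const scaler0 subr0.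
have -> : ((1%:M - s *: A : 'M_n) ^+ k) i j - n%:R^-1 =
    \sum_l (P l i)^* * (1 - s * D 0 l) ^+ k * y l.
  have {1}-> : n%:R^-1 = n%:R^-1 * \sum_m (B ^+ k) i m :> C.
    rewrite [X in _ * X](_ : _ = 1) ?mulr1 //.
    move/matrixP/(_ i 0): Bconst; rewrite !mxE => <-.
    by apply: eq_bigr => m _; rewrite mxE mulr1.
  have E m : (B ^+ k) i m = \sum_l (P l i)^* * (1 - s * D 0 l) ^+ k * P l m.
    rewrite powE -mulmxA mxE; apply: eq_bigr => l _.
    by rewrite mul_diag_mx invmx_unitary // !mxE mulrA.
  rewrite -/B E (eq_bigr _ (fun m _ => E m)) exchange_big /= mulr_sumr -sumrB.
  apply: eq_bigr => l _; rewrite -mulr_sumr -PyE; ring.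
apply: le_trans (ler_norm_sum _ _ _) _.
apply: (@le_trans _ _ (\sum_l q ^+ k * ((`|P l i| ^+ 2 + `|P l j| ^+ 2) / 2))).
  apply: ler_sum => l _; rewrite !normrM norm_conjC normrX /y.
  have AG : `|P l i| * `|P l j| <= (`|P l i| ^+ 2 + `|P l j| ^+ 2) / 2.
    rewrite ler_pdivlMr ?ltr0n // -subr_ge0.
    have -> : `|P l i| ^+ 2 + `|P l j| ^+ 2 - `|P l i| * `|P l j| * 2 =
      (`|P l i| - `|P l j|) ^+ 2 by ring.
    by apply: real_exprn_even_ge0 => //; rewrite rpredB ?normr_real.
  have le0 : 0 <= (`|P l i| ^+ 2 + `|P l j| ^+ 2) / 2.
    by rewrite divr_ge0 ?addr_ge0 ?exprn_ge0.
  case: ifPn => [_|Dl0]; first by rewrite normr0 mulr0 mulr_ge0 ?exprn_ge0.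
  rewrite mulrAC mulrC; apply: ler_pM => //; rewrite ?mulr_ge0 ?exprn_ge0 //.
  by rewrite lerXn2r ?nnegrE ?normr_ge0 // A_gap.
rewrite -mulr_sumr -mulr_suml big_split /= !colP -[1 + 1]/(2%:R) divff ?mulr1 //.
Qed.

End SpectralDecay.

Section SpectralDiameter.
Context (R : realType) (T : finType) (e : rel T) (d : nat) (eps : R).
Hypothesis e_sym : symmetric e.
Hypothesis e_deg : forall x, (#|[pred y | e x y]| <= d)%N.
Hypothesis eps_gt0 : 0 < eps.
Hypothesis e_gap : spectral_gap e eps.
Local Notation n := #|T|.
Local Notation L := (laplacian R e).
Local Notation f := (real_complex R).

Lemma degree_sum (i : 'I_n) : (#|[pred y | e (enum_val i) y]|)%:R =
  \sum_(j < n) (e (enum_val i) (enum_val j))%:R :> R.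
Proof.
rewrite -sum1_card natr_sum /= [RHS](reindex (@enum_rank T)) /=; last first.
  by exists enum_val => x _; rewrite ?enum_rankK ?enum_valK.
under [RHS]eq_bigr do rewrite enum_rankK.
by rewrite big_mkcond /=; apply: eq_bigr => y _; rewrite inE; case: (e _ y).
Qed.

Lemma laplacian_row i : \sum_j L i j = 0.
Proof.
under eq_bigr do rewrite mxE.
rewrite sumrB (bigD1 i) //= eqxx mul1r big1 ?addr0; last first.
  by move=> j /negbTE ji; rewrite eq_sym ji mul0r.
by rewrite degree_sum subrr.
Qed.

Lemma laplacian_sym : L^T = L.
Proof.
apply/matrixP=> i j; rewrite !mxE e_sym eq_sym.
by case: eqVneq => [->|] //; rewrite !mul0r.
Qed.

(** Evaluate [v *m L = a *: v] at a coordinate where [|v|] is largest: the absolute row sums of [L]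
    are at most twice the degree bound. *)
Lemma laplacian_eigenvalue_le a : eigenvalue L a -> a <= (2 * d)%:R.
Proof.
case/eigenvalueP => v vL v0.
have [i0 vi0] : exists i, v 0 i != 0 by apply/rV0Pn.
pose i := [arg max_(j > i0) `|v 0 j|]%O.
have vi j : `|v 0 j| <= `|v 0 i|.
  by rewrite /i; case: Order.TotalTheory.arg_maxP => // k _ /(_ j isT).
have vi_gt0 : 0 < `|v 0 i|.
  by apply: lt_le_trans (vi i0); rewrite normr_gt0.
rewrite -(ler_pM2r vi_gt0); apply: le_trans (ler_norm _) _.
rewrite normrM normr_id -normrM.
have -> : a * v 0 i = \sum_j v 0 j * L j i.
  by move/rowP: vL => /(_ i); rewrite !mxE.
apply: le_trans (ler_norm_sum _ _ _) _.
apply: (@le_trans _ _ (\sum_j `|v 0 i| * `|L j i|)).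
  by apply: ler_sum => j _; rewrite normrM ler_wpM2r.
rewrite -mulr_sumr mulrC ler_wpM2r //.
apply: (@le_trans _ _ (\sum_j ((i == j)%:R * d%:R +
   (e (enum_val i) (enum_val j))%:R))).
  apply: ler_sum => j _; rewrite -[L]laplacian_sym !mxE.
  apply: le_trans (ler_normB _ _) _; apply: lerD; last by rewrite ger0_norm.
  by rewrite ger0_norm ?mulr_ge0 // ler_wpM2l // ler_nat.
rewrite big_split /= -degree_sum (bigD1 i) //= eqxx mul1r big1 ?addr0; last first.
  by move=> j /negbTE ji; rewrite eq_sym ji mul0r.
by rewrite mul2n -addnn natrD lerD2l ler_nat.
Qed.

(** A nonzero off-diagonal entry of one factor forces an edge, while a diagonal entry stays in
    place; hence at most [k] edges. *)
Lemma laplacian_power_path (s : R) k i j :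
  ((1%:M - s *: L : 'M_n) ^+ k) i j != 0 ->
  exists2 p, path e (enum_val i) p & last (enum_val i) p = enum_val j /\ (size p <= k)%N.
Proof.
elim: k i => [|k IH] i.
  rewrite expr0 mxE; case: (eqVneq i j) => [-> _|_]; last by rewrite mulr0n eqxx.
  by exists [::].
rewrite exprS mxE; case: (pselect (exists2 m,
  (1%:M - s *: L) i m != 0 & ((1%:M - s *: L : 'M_n) ^+ k) m j != 0)).
  move=> [m Bim /IH[p ep [lp sp]]] _.
  move: Bim; rewrite !mxE; case: (eqVneq i m) => [im _|im].
    by exists p; rewrite im //; split=> //; apply: ltnW.
  rewrite mul0r !sub0r mulrN opprK mulf_eq0 negb_or => /andP[_].
  case em : (e _ _); last by rewrite eqxx.
  by move=> _; exists (enum_val m :: p); rewrite /= ?em.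
move=> H; rewrite big1 ?eqxx // => m _; apply/eqP; apply: contrapT => /negP.
by rewrite mulf_eq0 negb_or => /andP[? ?]; apply: H; exists m.
Qed.

(** For [s = 1 / (2 d + eps)], every nonzero eigenvalue [a] lies between [eps] and [2 d], so
    [0 <= 1 - s a <= q]. Without a path of length at most [k] the corresponding entry of the k-th
    power is 0, and spectral decay gives [1 / n <= q ^ k]. The summand [eps] in the denominator
    keeps it positive even when [d] is 0. *)
Lemma spectral_diameter k : n%:R * (1 - eps / ((2 * d)%:R + eps)) ^+ k < 1 ->
  forall x y : T, exists2 p, path e x p & last x p = y /\ (size p <= k)%N.
Proof.
move=> nk x y; rewrite -[x]enum_rankK -[y]enum_rankK.
set i := enum_rank x; set j := enum_rank y.
set t : R := (2 * d)%:R + eps in nk *.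
have t_gt0 : 0 < t by rewrite ltr_wpDl.
set q := 1 - eps / t in nk *.
have q_ge0 : 0 <= q.
  by rewrite subr_ge0 ler_pdivrMr // mul1r /t lerDr.
apply: (@laplacian_power_path t^-1); apply/eqP => B0.
have n_gt0 : (0 < n)%N by apply/card_gt0P; exists x.
have [rk gap] := e_gap.
have Lrow : L *m const_mx 1 = 0 :> 'cV_n.
  apply/colP=> m; rewrite !mxE -[RHS](laplacian_row m).
  by apply: eq_bigr => l _; rewrite [const_mx _ _ _]mxE mulr1.
(* The spectral theorem is applied over the complex numbers, so symmetry, kernel rank and gap are
   carried over from the real Laplacian. *)
pose LC := map_mx f L.
have LC_herm : LC \is hermsymmx.
  apply: realsym_hermsym.
    by apply/is_hermitianmxP; rewrite expr0 scale1r map_mx_id // map_trmx laplacian_sym.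
  by apply/mxOverP => l m; rewrite mxE; apply/complex_realP; eexists.
have fconst r : map_mx f (const_mx 1 : 'cV_r) = const_mx 1.
  by apply/colP=> l; rewrite !mxE rmorph1.
have LC_const : LC *m const_mx 1 = 0 :> 'cV_n.
  by rewrite -fconst -map_mxM Lrow map_mx0.
have LC_ker (v : 'rV_n) : v *m LC = 0 -> forall l m, v 0 l = v 0 m.
  have cL : (const_mx 1 : 'rV_n) *m LC = 0.
    by apply: trmx_inj; rewrite trmx_mul map_trmx laplacian_sym trmx_const trmx0.
  have c0 : (const_mx 1 : 'rV[R[i]]_n) != 0.
    by apply/rV0Pn; exists i; rewrite mxE oner_neq0.
  have rkC : (\rank (kermx LC) <= 1)%N.
    by rewrite mxrank_ker mxrank_map -mxrank_ker -[L]subr0 -(raddf0 (@scalar_mx _ n)).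
  move=> /sub_kermxP vk; have /sub_kermxP ck := cL.
  have : (kermx LC <= (const_mx 1 : 'rV_n))%MS.
    rewrite -(geq_leqif (mxrank_leqif_sup ck)) rank_rV c0 //.
  move=> /(submx_trans vk) /sub_rVP[c ->] l m; by rewrite !mxE.
have LC_gap a : a \is Num.real -> eigenvalue LC a -> a != 0 ->
    `|1 - f t^-1 * a| <= f q.
  move=> /complex_realP[r ->] er r0.
  have {}er : eigenvalue L r.
    by move: er; rewrite !eigenvalue_root_char -map_char_poly fmorph_root.
  have {}r0 : r != 0 by apply: contra_neq r0 => ->.
  have rt : r <= t.
    by apply: le_trans (laplacian_eigenvalue_le er) _; rewrite lerDl ltW.
  rewrite -[1](rmorph1 f) -[r%:C%C]/(f r) -rmorphM -rmorphB /= ger0_norm.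
    by rewrite lecR /q lerD2l lerN2 mulrC ler_wpM2l ?invr_ge0 ?(ltW t_gt0) ?gap.
  by rewrite ler0c subr_ge0 mulrC ler_pdivrMr // mul1r.
have fq0 : 0 <= f q by rewrite ler0c.
have := spectral_decay LC_herm LC_const LC_ker fq0 LC_gap k i j.
have -> : (1%:M - f t^-1 *: LC) = map_mx f (1%:M - t^-1 *: L).
  by rewrite map_mxB map_mx1 map_mxZ.
have -> (B : 'M[R]_n) : (map_mx f B : 'M_n) ^+ k = map_mx f (B ^+ k).
  elim: (k) => [|h IH]; first by rewrite !expr0 map_mx1.
  by rewrite !exprS IH map_mxM.
rewrite mxE B0 rmorph0 sub0r normrN ger0_norm ?invr_ge0 ?ler0n //.
rewrite -(rmorph_nat f) -fmorphV -rmorphXn lecR.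
by rewrite -div1r ler_pdivrMr ?ltr0n // mulrC leNgt nk.
Qed.

End SpectralDiameter.

(** * Cosets, words and the derived subgroup *)

Lemma seq_bound_fset_set (T : choiceType) (A : set T) (l : seq T) :
  (forall x, A x -> x \in l) -> finite_set A /\ (#|` fset_set A| <= size l)%N.
Proof.
move=> Al; have finA : finite_set A.
  by apply: sub_finite_set (finite_seq l) => x /Al.
split=> //; apply: uniq_leq_size; first exact: fset_uniq.
by move=> x; rewrite in_fset_set // => /set_mem/Al.
Qed.

Section GroupFacts.
Context (G : groupType).
Implicit Types (H N : subgroup G) (S : {fset G}).
Local Open Scope group_scope.

Lemma subgroup1 H : (H : set G) 1.
Proof. by case: (subgroupP H). Qed.

Lemma subgroupM H x y : (H : set G) x -> (H : set G) y -> (H : set G) (x * y).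
Proof. by case: (subgroupP H) => _ + _; apply. Qed.

Lemma subgroupV H x : (H : set G) x -> (H : set G) x^-1.
Proof. by case: (subgroupP H) => _ _; apply. Qed.

Lemma lcoset_id H g : lcoset H g g.
Proof. by exists 1; [exact: subgroup1|rewrite mulg1]. Qed.

Lemma lcosetP H g h : lcoset H g h <-> (H : set G) (g^-1 * h).
Proof.
split=> [[x Hx <-]|Hgh]; first by rewrite mulKg.
by exists (g^-1 * h); rewrite // mulVKg.
Qed.

Lemma lcoset_eqP H g h : lcoset H g = lcoset H h <-> (H : set G) (g^-1 * h).
Proof.
split=> [E|Hgh]; first by apply/lcosetP; rewrite E; apply: lcoset_id.
apply/seteqP; split=> x /lcosetP Hx; apply/lcosetP.
  have -> : h^-1 * x = (g^-1 * h)^-1 * (g^-1 * x).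
    by rewrite invgM invgK -mulgA mulVKg.
  exact: subgroupM (subgroupV Hgh) Hx.
have -> : g^-1 * x = g^-1 * h * (h^-1 * x) by rewrite -mulgA mulVKg.
exact: subgroupM.
Qed.

Lemma gen_subgroupP (A : set G) : is_subgroup (gen A).
Proof.
split=> [H [HP _]|x y gx gy H HA|x gx H HA]; first by case: HP.
  by have [[_ HM _] _] := HA; apply: HM; [apply: gx|apply: gy].
by have [[_ _ HV] _] := HA; apply: HV; apply: gx.
Qed.

Lemma sub_gen (A : set G) : A `<=` gen A.
Proof. by move=> x Ax H [_]; apply. Qed.

Lemma gen_ind (A : set G) (H : subgroup G) : A `<=` H -> gen A `<=` H.
Proof. by move=> AH x; apply; split=> //; apply: subgroupP. Qed.

Definition derived_subgroup (H : subgroup G) : subgroup G :=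
  Subgroup (gen_subgroupP
    [set c : G | exists x y, [/\ (H : set G) x, (H : set G) y & c = [~ x, y]]]).

Lemma derived_sub H : derived H `<=` H.
Proof.
apply: gen_ind => _ [x [y [Hx Hy ->]]]; rewrite /commg /conjg.
by do !apply: subgroupM => //; apply: subgroupV.
Qed.

Lemma derived_normal N : normal_set N -> normal_set (derived N).
Proof.
move=> nN x g Nx.
have K : is_subgroup [set x : G | derived N (x ^ g)].
  split=> [|y z /= Ny Nz|y /= Ny]; rewrite /= ?conj1g ?conjMg ?conjVg.
  - exact: (subgroup1 (derived_subgroup N)).
  - exact: (subgroupM (H := derived_subgroup N)).
  - exact: (subgroupV (H := derived_subgroup N)).
apply: (@gen_ind _ (Subgroup K)) Nx => _ [y [z [Ny Nz ->]]] /=.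
by rewrite conjRg; apply: sub_gen; exists (y ^ g), (z ^ g); split=> //; apply: nN.
Qed.

(** A coset of the derived subgroup is determined by the coset of [N] containing it together with a
    class in the abelianization, obtained by translating back with a chosen representative. *)
Lemma derived_index N : finite_index N -> finite_set (abelianization N) ->
  finite_index (derived N) /\
  (coset_index (derived N) <= coset_index N * #|` fset_set (abelianization N)|)%N.
Proof.
move=> finN finT.
have /choice[r rP] : forall A : set G, exists g, cosets N A -> lcoset N g = A.
  by move=> A; case: (pselect (cosets N A)) => [[g _ <-]|nA]; [exists g|exists 1].
pose f (AB : set G * set G) := [set r AB.1 * b | b in AB.2].
have sub : cosets (derived N) `<=` f @` (cosets N `*` abelianization N).
  move=> _ [g _ <-]; have cg : cosets N (lcoset N g) by exists g.
  have /lcoset_eqP Ng := rP _ cg.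
  exists (lcoset N g, lcoset (derived N) ((r (lcoset N g))^-1 * g)).
    by split=> //=; exists ((r (lcoset N g))^-1 * g).
  apply/seteqP; split=> x /=.
    by move=> [_ [y Ny <-] <-]; exists y => //; rewrite !mulgA mulgV mul1g.
  move=> [y Ny <-]; exists ((r (lcoset N g))^-1 * g * y); first by exists y.
  by rewrite !mulgA mulgV mul1g.
pose l := [seq f (A, B) | A <- fset_set (cosets N), B <- fset_set (abelianization N)].
have lP A : cosets (derived N) A -> A \in l.
  move=> /sub[[B E] [/= cB tE] <-]; apply: allpairs_f.
    by rewrite in_fset_set //; apply/mem_set.
  by rewrite in_fset_set //; apply/mem_set.
by have [fD sD] := seq_bound_fset_set lP; split=> //; rewrite size_allpairs in sD.
Qed.

Definition is_letter S (x : G) : bool := (x \in S) || (x^-1 \in S).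

Lemma rtransM (A : set G) s t : rtrans (rtrans A s) t = rtrans A (s * t).
Proof.
apply/seteqP; split=> x /= [y].
  by move=> [z Az <-] <-; exists z; rewrite // mulgA.
by move=> Ay <-; exists (y * s); [exists y|rewrite mulgA].
Qed.

Lemma rtrans1 (A : set G) : rtrans A 1 = A.
Proof.
apply/seteqP; split=> x /= => [[y Ay <-]|Ax]; first by rewrite mulg1.
by exists x; rewrite ?mulg1.
Qed.

Lemma cayley_adj_letter N S (A B : fset_set (cosets N)) :
  @cayley_adj G N S A B -> exists2 s, is_letter S s & val B = rtrans (val A) s.
Proof.
move=> /andP[_ /existsP[s /orP[/eqP E|/eqP E]]].
  by exists (val s); rewrite /is_letter ?(valP s).
exists (val s)^-1; first by rewrite /is_letter invgK (valP s) orbT.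
by rewrite -E rtransM mulgV rtrans1.
Qed.

Lemma cayley_path_word N S (A : fset_set (cosets N)) p :
  path (@cayley_adj G N S) A p -> exists w : seq G,
  [/\ all (is_letter S) w, size w = size p
    & val (last A p) = rtrans (val A) (\prod_(x <- w) x)].
Proof.
elim: p A => [|B p IH] A /=; first by exists [::]; rewrite big_nil rtrans1.
move=> /andP[/cayley_adj_letter[s ls Bs] /IH[w [lw sw ->]]].
by exists (s :: w); rewrite /= ls lw sw big_cons Bs rtransM.
Qed.

Lemma cayley_degree N S (A : fset_set (cosets N)) :
  (#|[pred B | @cayley_adj G N S A B]| <= 2 * #|` S|)%N.
Proof.
pose l := [seq rtrans (val A) s | s <- S] ++ [seq rtrans (val A) s^-1 | s <- S].
have -> : (2 * #|` S| = size l)%N by rewrite size_cat !size_map mul2n -addnn.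
rewrite cardE -(size_map val); apply: uniq_leq_size.
  by rewrite map_inj_uniq ?enum_uniq //; apply: val_inj.
move=> _ /mapP[B + ->]; rewrite mem_enum inE => /cayley_adj_letter[s /orP[]sS ->].
  by rewrite mem_cat map_f.
rewrite mem_cat; apply/orP; right; apply/mapP; exists s^-1 => //.
by rewrite invgK.
Qed.

Lemma cayley_sym N S : symmetric (@cayley_adj G N S).
Proof.
move=> A B; rewrite /cayley_adj eq_sym; congr andb.
by apply: eq_existsb => s; rewrite orbC.
Qed.

(** A path from the coset of 1 to the coset of [g] spells the word. The degree bound of the coset
    graph is [2 * #|S|], each generator being used in both directions. *)
Lemma gap_word (R : realType) (N : subgroup G) S (eps : R) k : finite_index N ->
  (0 < eps)%R -> spectral_gap (@cayley_adj G N S) eps ->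
  ((coset_index N)%:R * (1 - eps / ((2 * (2 * #|` S|))%:R + eps)) ^+ k < 1)%R ->
  forall g : G, exists w : seq G,
    [/\ all (is_letter S) w, (size w <= k)%N & lcoset N g (\prod_(x <- w) x)].
Proof.
move=> finN eps0 gap nk g.
have cP (h : G) : lcoset N h \in fset_set (cosets N).
  by rewrite in_fset_set //; apply/mem_set; exists h.
have nk' : (#|{: fset_set (cosets N)}|%:R *
    (1 - eps / ((2 * (2 * #|` S|))%:R + eps)) ^+ k < 1)%R.
  by rewrite -cardfE.
have [p ep [lp sp]] := spectral_diameter (@cayley_sym N S)
  (@cayley_degree N S) eps0 gap nk' [` cP 1]%fset [` cP g]%fset.
have [w [lw sw]] := cayley_path_word ep; rewrite lp /= => ->.
exists w; split=> //; first by rewrite sw.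
by exists 1; [apply: lcoset_id|rewrite mul1g].
Qed.

End GroupFacts.

(** * Integral chains *)

Section IntegerRank.
Context (V : zmodType).
Implicit Types (P : set V) (x y : V).

(** The rows are dependent over the rationals; multiplying the coefficients by the product of all
    their denominators makes them integers. *)
Lemma integer_dependency m b (c : 'M[int]_(m, b)) : (b < m)%N ->
  exists2 w : 'I_m -> int, exists i, w i != 0 & forall j, \sum_i w i * c i j = 0.
Proof.
move=> bm; pose A : 'M[rat]_(m, b) := map_mx intr c.
have : kermx A != 0.
  rewrite -mxrank_eq0 mxrank_ker subn_eq0 -ltnNge.
  exact: leq_ltn_trans (rank_leq_col _) bm.
move=> /rowV0Pn[v /sub_kermxP vA v0].
pose D := \prod_j denq (v 0 j).
have D0 : D != 0 by apply/prodf_neq0 => j _; apply: denq_neq0.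
pose w i := numq (v 0 i) * \prod_(j | j != i) denq (v 0 j).
have wE i : (w i)%:~R = v 0 i * D%:~R.
  rewrite /w /D [in RHS](bigD1 i) //= !intrM mulrA; congr (_ * _).
  by rewrite numqE.
exists w => [|j].
  have [i vi] : exists i, v 0 i != 0 by apply/rV0Pn.
  exists i; rewrite -(intr_eq0 rat) wE mulf_neq0 // intr_eq0; exact: D0.
apply/eqP; rewrite -(intr_eq0 rat) rmorph_sum /=; apply/eqP.
transitivity ((v *m A) 0 j * D%:~R); last by rewrite vA mxE mul0r.
rewrite mxE mulr_suml; apply: eq_bigr => i _.
by rewrite intrM wE mxE mulrAC.
Qed.

(** Steinitz exchange up to nonzero multiples: if [m > b], the integer coordinate rows of the
    multiples are dependent, and the dependency transfers to [S']. *)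
Lemma zindep_le b m (S : 'I_b -> V) (S' : 'I_m -> V) : zindep S' ->
  (forall i, exists2 k : int, k != 0 & zspan S (S' i *~ k)) -> (m <= b)%N.
Proof.
move=> indS' H.
have /boolp.choice[k kP] i : exists k : int, k != 0 /\ zspan S (S' i *~ k).
  by have [k ? ?] := H i; exists k.
rewrite leqNgt; apply/negP => bm.
have /boolp.choice[c cP] i : exists c : 'I_b -> int, S' i *~ k i = \sum_j S j *~ c j.
  by have [_ [c ->]] := kP i; exists c.
have [w [i wi] wc] := integer_dependency (\matrix_(i, j) c i j) bm.
have : \sum_i S' i *~ (k i * w i) = 0.
  under eq_bigr do rewrite mulrzA cP mulrz_suml.
  rewrite exchange_big big1 //= => j _.
  under eq_bigr do rewrite -mulrzA mulrC.
  rewrite -mulrz_sumr (_ : \sum_i _ = 0) ?mulr0z // -[RHS](wc j).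
  by apply: eq_bigr => l _; rewrite mxE.
move=> /indS'/(_ i)/eqP; rewrite mulf_eq0 (negbTE wi) orbF.
by have [/negbTE-> _] := kP i.
Qed.

(** Take an independent family of maximal size: adjoining [x] must create a relation, whose
    coefficient at [x] is nonzero because the family itself is independent. *)
Lemma maximal_zindep P B :
  (forall m (S : 'I_m -> V), (forall j, P (S j)) -> zindep S -> (m <= B)%N) ->
  exists b (S : 'I_b -> V), [/\ forall j, P (S j), zindep S &
    forall x, P x -> exists2 k : int, k != 0 & zspan S (x *~ k)].
Proof.
move=> PB; pose Q n := `[< exists2 S : 'I_n -> V, forall j, P (S j) & zindep S >].
have Q0 : exists n, Q n.
  by exists 0%N; apply/asboolP; exists (fun=> 0) => [[]|c _ []].
have Qle n : Q n -> (n <= B)%N by move=> /asboolP[S PS /PB]; apply.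
case: (ex_maxnP Q0 Qle) => b /asboolP[S PS indS] bmax.
exists b, S; split=> // x Px; apply: contrapT => nx.
suff /bmax : Q b.+1 by rewrite ltnn.
apply/asboolP; exists (fun j => if unlift ord_max j is Some i then S i else x).
  by move=> j; case: unliftP.
move=> c; rewrite big_ord_recr /= unlift_none.
rewrite (eq_bigr (fun j => S j *~ c (fintype.lift ord_max j))); last first.
  move=> j _; rewrite (_ : widen_ord _ j = fintype.lift ord_max j) ?liftK //.
  by apply: val_inj; rewrite /= /bump leqNgt ltn_ord.
move=> E; have cmax : c ord_max = 0.
  apply/eqP; apply: contrapT => /negP c0; apply: nx; exists (c ord_max) => //.
  exists (fun j => - c (fintype.lift ord_max j)); apply/esym/eqP.
  under eq_bigr do rewrite mulrNz.
  by rewrite sumrN eq_sym -addr_eq0 addrC E.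
move: E; rewrite cmax mulr0z addr0 => /indS c0 j.
by case: (unliftP ord_max j) => [i ->|->].
Qed.

(** The subgroup generated by [P], in impredicative form so that induction on membership is
    immediate. Dividing by it turns congruences between chains into equations in [zquot P]. *)
Definition zgen P : set V :=
  [set x | forall Q : set V, Q 0 -> (forall y z, Q y -> Q z -> Q (y - z)) ->
     P `<=` Q -> Q x].

Lemma sub_zgen P : P `<=` zgen P.
Proof. by move=> x Px Q _ _; apply. Qed.

Lemma zgen_ind P Q : Q 0 -> (forall y z, Q y -> Q z -> Q (y - z)) ->
  P `<=` Q -> zgen P `<=` Q.
Proof. by move=> Q0 QB PQ x; apply. Qed.

Lemma zgen0 P : zgen P 0. Proof. by move=> Q. Qed.

Lemma zgenB P x y : zgen P x -> zgen P y -> zgen P (x - y).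
Proof. by move=> Px Py Q Q0 QB PQ; apply: (QB x y); [apply: Px|apply: Py]. Qed.

Definition zgen_pred P : {pred V} := fun x => `[< zgen P x >].

Lemma zgen_zmod_closed P : zmod_closed (zgen_pred P).
Proof.
split=> [|x y]; rewrite !unfold_in; first by apply/asboolP; exact: zgen0.
by move=> /asboolP Px /asboolP Py; apply/asboolP; exact: (zgenB Px Py).
Qed.

HB.instance Definition _ P :=
  GRing.isZmodClosed.Build V (zgen_pred P) (zgen_zmod_closed P).

Definition zquot P : zmodType := (Quotient.quot (zgen_pred P)).

Definition zproj P (x : V) : zquot P := \pi_(Quotient.quot (zgen_pred P))%qT x.

Lemma zproj_is_zmod_morphism P : zmod_morphism (zproj P).
Proof. by move=> x y; rewrite /zproj !raddfB. Qed.

HB.instance Definition _ P :=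
  GRing.isZmodMorphism.Build V (zquot P) (zproj P) (zproj_is_zmod_morphism P).

Lemma zproj_eq0 P x : zproj P x = 0 <-> zgen P x.
Proof.
rewrite -(raddf0 (zproj P)); split.
  by move=> /eqP; rewrite -Quotient.idealrBE subr0 => /asboolP.
by move=> Px; apply/eqP; rewrite -Quotient.idealrBE subr0; apply/asboolP.
Qed.

(** Elements with a nonzero multiple in the span are closed under differences: the product of the
    two multipliers serves both. *)
Lemma zgen_zspan b (S : 'I_b -> V) P :
  (forall x, P x -> exists2 k : int, k != 0 & zspan S (x *~ k)) ->
  forall x, zgen P x -> exists2 k : int, k != 0 & zspan S (x *~ k).
Proof.
move=> PS; apply: zgen_ind => //.
  exists 1 => //; exists (fun=> 0); rewrite mul0rz big1 //.
move=> y z [k k0 [c cE]] [l l0 [d dE]]; exists (k * l); first exact: mulf_neq0.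
exists (fun j => c j * l - d j * k).
rewrite mulrzBl mulrzA cE mulrC mulrzA dE !mulrz_suml -sumrB.
by apply: eq_bigr => j _; rewrite -!mulrzA -mulrzBr.
Qed.

End IntegerRank.

(** * The l1 norm on free abelian groups *)

Section L1Norm.
Context (K : choiceType).
Implicit Types (c d : {freeg K / int}).

Lemma l1normE c (s : seq K) : uniq s -> {subset dom c <= s} ->
  l1norm c = \sum_(k <- s) `|coeff k c|.
Proof.
move=> us sub; rewrite [RHS](bigID [in dom c]) /= [X in _ + X]big1 ?addr0.
  rewrite -big_filter; apply: perm_big; apply: uniq_perm.
  - exact: uniq_dom.
  - exact: filter_uniq.
  - by move=> k; rewrite mem_filter andb_idr // => /sub.
by move=> k /coeff_outdom ->; rewrite normr0.
Qed.

Lemma l1norm_ge0 c : 0 <= l1norm c.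
Proof. by apply: sumr_ge0 => k _. Qed.

Lemma l1normD c d : l1norm (c + d) <= l1norm c + l1norm d.
Proof.
pose s := undup (dom c ++ dom d).
rewrite (@l1normE c s) ?undup_uniq //; last first.
  by move=> k kc; rewrite mem_undup mem_cat kc.
rewrite (@l1normE d s) ?undup_uniq //; last first.
  by move=> k kd; rewrite mem_undup mem_cat kd orbT.
rewrite (@l1normE (c + d) s) ?undup_uniq //; last first.
  by move=> k /domD_subset; rewrite mem_undup.
by rewrite -big_split /=; apply: ler_sum => k _; rewrite coeffD ler_normD.
Qed.

Lemma l1normN c : l1norm (- c) = l1norm c.
Proof.
rewrite (@l1normE (- c) (dom c)) ?uniq_dom //; last by move=> k; rewrite domN.
by apply: eq_bigr => k _; rewrite coeffN normrN.
Qed.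

Lemma l1normB c d : l1norm (c - d) <= l1norm c + l1norm d.
Proof. by rewrite -(l1normN d); apply: l1normD. Qed.

Lemma l1norm0 : l1norm (0 : {freeg K / int}) = 0.
Proof. by rewrite /l1norm dom0 big_nil. Qed.

Lemma l1normU (n : int) (k : K) : l1norm << n *g k >> = `|n|.
Proof.
have [->|n0] := eqVneq n 0; first by rewrite freegU0 l1norm0.
by rewrite /l1norm domU // big_seq1 coeffU eqxx mulr1.
Qed.

Lemma l1norm_sum (I : Type) (r : seq I) (F : I -> {freeg K / int}) :
  l1norm (\sum_(i <- r) F i) <= \sum_(i <- r) l1norm (F i).
Proof.
elim/big_rec2: _ => [|i x y _ le]; first by rewrite l1norm0.
by apply: le_trans (l1normD _ _) _; rewrite lerD2l.
Qed.

Lemma l1norm_ge1 c : c != 0 -> 1 <= l1norm c.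
Proof.
rewrite -dom_eq0 /l1norm => c0.
have : {in dom c, forall k, 1 <= `|coeff k c|}.
  by move=> k; rewrite mem_dom -normr_gt0 -gtz0_ge1.
case: (dom c) c0 => // k s _ H; rewrite big_cons; apply: (@le_trans _ _ `|coeff k c|).
  by apply: H; rewrite mem_head.
by rewrite lerDl; apply: sumr_ge0.
Qed.

Lemma fglift_is_zmod_morphism (M : lmodType int) (f : K -> M) :
  zmod_morphism (fglift f).
Proof. exact: lift_is_additive. Qed.

HB.instance Definition _ (M : lmodType int) (f : K -> M) :=
  GRing.isZmodMorphism.Build {freeg K / int} M (fglift f)
    (fglift_is_zmod_morphism f).

Lemma freegU_scale (n : int) (k : K) : << n *g k >> = << k >> *~ n :> {freeg K / int}.
Proof. by rewrite freegU_mulz intz. Qed.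

Lemma freeg_ind (P : {freeg K / int} -> Prop) : P 0 ->
  (forall x y, P x -> P y -> P (x - y)) -> (forall k, P << k >>) -> forall c, P c.
Proof.
move=> P0 PB PU c.
have PD x y : P x -> P y -> P (x + y).
  by move=> Px Py; rewrite -[y]opprK; apply: (PB) => //; rewrite -sub0r; apply: PB.
rewrite -[c]freeg_sumE; elim/big_ind: _ => // k _.
rewrite freegU_scale; move: (coeff k c) => [n|n].
  by elim: n => // n IH; rewrite -addn1 PoszD mulrzDr; apply: PD => //; rewrite mulr1z.
rewrite NegzE mulrNz -sub0r; apply: PB => //.
elim: n => [|n IH]; first by rewrite [X in P X]mulr1z.
by rewrite -addn1 PoszD mulrzDr; apply: PD => //; rewrite [X in P X]mulr1z.
Qed.

End L1Norm.

Lemma sumr_seq_const (V : zmodType) (I : Type) (r : seq I) (x : V) :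
  \sum_(i <- r) x = x *+ size r.
Proof. by rewrite big_const_seq count_predT iter_addr_0. Qed.

Lemma addrB_telescope (V : zmodType) (a b c d e : V) :
  (a - b - c) + (d - a - e) = d - b - (c + e).
Proof.
by rewrite opprD addrC !addrA (addrAC (d - a)) subrK (addrAC d) (addrAC (d - b)).
Qed.

Ltac freeg_ring :=
  apply/eqP/freeg_eqP => ?; rewrite !(coeffB, coeffD, coeffN, coeff0); ring.

(** * Boundaries, chains of walks and homology classes *)

Section Boundary.
Context (X : complex).

Lemma boundary2_is_zmod_morphism : zmod_morphism (@boundary2 X).
Proof. exact: fglift_is_zmod_morphism. Qed.

HB.instance Definition _ :=
  GRing.isZmodMorphism.Build (chain2 X) (chain1 X) (@boundary2 X)
    boundary2_is_zmod_morphism.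

Lemma boundary2U (f : face X) : boundary2 << f >> = boundary_face f.
Proof. by rewrite /boundary2 liftU scale1r. Qed.

Definition letter_sign (a : edge X * bool) : int := (-1) ^+ (~~ a.2).

Definition walk_chain (p : seq (edge X * bool)) : chain1 X :=
  \sum_(a <- p) << letter_sign a *g a.1 >>.

Lemma walk_chain_cat p q : walk_chain (p ++ q) = walk_chain p + walk_chain q.
Proof. exact: big_cat. Qed.

Lemma l1norm_walk_chain p : l1norm (walk_chain p) <= (size p)%:Z.
Proof.
apply: le_trans (l1norm_sum _ _) _; rewrite -natz -sumr_seq_const.
by apply: ler_sum => -[e []] _; rewrite l1normU.
Qed.

(** The target is all 1-chains modulo boundaries, not only cycles modulo boundaries, so that open
    walks also have a class. *)
Definition homology_class : chain1 X -> zquot (range (@boundary2 X)) :=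
  zproj (range (@boundary2 X)).

HB.instance Definition _ := GRing.Additive.copy homology_class
  (zproj (range (@boundary2 X))).

Lemma homology_class0P z : homology_class z = 0 <-> range (@boundary2 X) z.
Proof.
rewrite zproj_eq0; split; last exact: sub_zgen.
apply: zgen_ind => //; first by exists 0; rewrite // raddf0.
by move=> _ _ [A _ <-] [B _ <-]; exists (A - B); rewrite // raddfB.
Qed.

End Boundary.

(** * Two-cycles of small norm span up to finite index *)

Section SmallCycles.
Context (X : complex).
Local Notation cls := (@homology_class X).
Local Notation Q1 := (zquot (range (@boundary2 X))).
(** In the application [P v] is the chain of a short walk from the base vertex to [v], [ts] lists
    the finite group of classes of loops at the base vertex, [l] chooses short representatives, and
    [m] bounds the lengths of the faces. *)
Context (P : vert X -> chain1 X) (ts : seq Q1) (l : Q1 -> chain1 X).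
Context (L K : int) (m : nat).

(** The edge closed up to a loop at the base vertex by means of the chosen walks. *)
Definition petal (e : edge X) : chain1 X := P (src e) + << e >> - P (tgt e).

Hypothesis ts_uniq : uniq ts.
Hypothesis ts0 : 0 \in ts.
Hypothesis tsD : forall s t, s \in ts -> t \in ts -> s + t \in ts.
Hypothesis clsl : forall t, t \in ts -> cls (l t) = t.
Hypothesis norm_l : forall t, t \in ts -> l1norm (l t) <= L.
Hypothesis cls_petal : forall e, cls (petal e) \in ts.
Hypothesis norm_petal : forall e, l1norm (petal e) <= L *+ 2.
Hypothesis K_ge0 : 0 <= K.
Hypothesis m_ge2 : (2 <= m)%N.
Hypothesis fillK : forall z, range (@boundary2 X) z -> l1norm z <= L *+ 3 ->
  exists2 A, boundary2 A = z & l1norm A <= K.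
Hypothesis bnd_m : forall f : face X, (size (bnd f) <= m)%N.

(** The bound allows for one face, at most [m] fillings comparing petals with short representatives,
    and at most [m] cocycle values along the boundary of the face. *)
Definition small_cycles : set (chain2 X) :=
  [set S | H2 X S /\ l1norm S <= 1 + K *+ (2 * m)].

Local Notation pr := (zproj small_cycles).

(** Translation is an injection of a finite list into itself. This gives [ts] inverses and permits
    averaging over it. *)
Lemma ts_translate t : t \in ts -> perm_eq [seq t + u | u <- ts] ts.
Proof.
move=> tT; have ut : uniq [seq t + u | u <- ts].
  by rewrite map_inj_uniq //; apply: addrI.
apply: uniq_perm => //; apply: (uniq_min_size ut _ _).2; rewrite ?size_map //.
by move=> _ /mapP[u uT ->]; apply: tsD.
Qed.

Lemma tsN t : t \in ts -> - t \in ts.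
Proof.
move=> tT; move: ts0; rewrite -(perm_mem (ts_translate tT)) => /mapP[u uT /eqP].
by rewrite eq_sym addrC addr_eq0 => /eqP <-.
Qed.

Lemma fill_exists : exists fl : chain1 X -> chain2 X, forall z,
  cls z = 0 -> l1norm z <= L *+ 3 -> boundary2 (fl z) = z /\ l1norm (fl z) <= K.
Proof.
suff /boolp.choice[fl flP] : forall z, exists A, cls z = 0 -> l1norm z <= L *+ 3 ->
    boundary2 A = z /\ l1norm A <= K by exists fl.
move=> z; case: (pselect (cls z = 0 /\ l1norm z <= L *+ 3)) => [[]|nz].
  move=> /homology_class0P z0 zL.
  by have [A AE AK] := fillK z0 zL; exists A.
by exists 0 => z0 zL; case: nz.
Qed.

(* The fillings of [l (s + t) - l s - l t] form a 2-cocycle of the finite group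
   [ts] modulo small cycles, and averaging over [ts] exhibits [size ts] times
   this cocycle as a coboundary. *)
Lemma small_cycles_span A : H2 X A -> zgen small_cycles (A *+ size ts).
Proof.
have [fl flP] := fill_exists.
pose F s t := fl (l (s + t) - l s - l t).
pose D e := fl (petal e - l (cls (petal e))).
have FP s t : s \in ts -> t \in ts ->
    boundary2 (F s t) = l (s + t) - l s - l t /\ l1norm (F s t) <= K.
  move=> sT tT; apply: flP.
    by rewrite !raddfB /= !clsl ?tsD // addrAC addrK subrr.
  apply: le_trans (l1normB _ _) _; rewrite mulrS addrC lerD ?norm_l //.
  by apply: le_trans (l1normB _ _) _; rewrite mulrS lerD ?norm_l ?tsD.
have DP e : boundary2 (D e) = petal e - l (cls (petal e)) /\ l1norm (D e) <= K.
  apply: flP; first by rewrite raddfB /= clsl // subrr.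
  by apply: le_trans (l1normB _ _) _; rewrite mulrS addrC lerD ?norm_l.
have smallP S : boundary2 S = 0 -> l1norm S <= 1 + K *+ (2 * m) -> pr S = 0.
  by move=> S0 SK; apply/zproj_eq0; apply: sub_zgen.
(* Both sides fill the same 1-chain, so they differ by a 2-cycle of norm at most [4 K], which is at
   most [2 m K] since [m >= 2]. *)
have cocycle s t u : s \in ts -> t \in ts -> u \in ts ->
    pr (F s t) + pr (F (s + t) u) = pr (F s (t + u)) + pr (F t u).
  move=> sT tT uT; apply/eqP; rewrite -subr_eq0 -!raddfD -raddfB; apply/eqP/smallP.
    rewrite raddfB !raddfD /= (FP _ _ sT tT).1 (FP _ _ (tsD sT tT) uT).1.
    rewrite (FP _ _ sT (tsD tT uT)).1 (FP _ _ tT uT).1 (addrA s t u).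
    by freeg_ring.
  apply: le_trans (l1normB _ _) _.
  apply: (@le_trans _ _ (K + K + (K + K))).
    apply: lerD; apply: le_trans (l1normD _ _) _; apply: lerD.
    - exact: (FP _ _ sT tT).2.
    - exact: (FP _ _ (tsD sT tT) uT).2.
    - exact: (FP _ _ sT (tsD tT uT)).2.
    - exact: (FP _ _ tT uT).2.
  have -> : K + K + (K + K) = K *+ 4 by ring.
  apply: le_trans (_ : K *+ (2 * m) <= _); last by rewrite lerDr.
  by rewrite ler_wpMn2l // (leq_mul2l 2 2).
(* Summing the cocycle identity over [u], with the translation by [t] reindexed away, exhibits
   [size ts] times [F] as the coboundary of [w]. *)
pose w t := - \sum_(u <- ts) F t u.
have wE t : pr (w t) = - \sum_(u <- ts) pr (F t u).
  by rewrite /w raddfN raddf_sum.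
have F_split s t : s \in ts -> t \in ts ->
    pr (F s t) *+ size ts = pr (w (s + t)) - pr (w s) - pr (w t).
  move=> sT tT; rewrite !wE !opprK -addrA.
  have <- : \sum_(u <- ts) pr (F s t) = pr (F s t) *+ size ts.
    exact: sumr_seq_const.
  rewrite -[\sum_(u <- ts) pr (F s u)](perm_big _ (ts_translate tT)) big_map /=.
  apply/eqP; rewrite addrC -subr_eq opprK -!big_split /=; apply/eqP.
  by rewrite !big_seq; apply: eq_bigr => u uT; apply: cocycle.
pose te e := cls (petal e).
pose sg (a : edge X * bool) := letter_sign a.
have sgE a : sg a = if a.2 then 1 else -1 by case: a => e [].
pose nxt s a := s + te a.1 *~ sg a.
(* [H s p] collects one cocycle value per letter while the partial sums of the classes are followed
   from [s]. A reversed letter uses the negated value at the class reached after the step. *)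
pose H1 s (a : edge X * bool) := if a.2 then F s (te a.1) else - F (s - te a.1) (te a.1).
pose fix H s p := if p is a :: p' then H1 s a + H (nxt s a) p' else 0.
have nxtT s a : s \in ts -> nxt s a \in ts.
  move=> sT; rewrite /nxt sgE; case: a.2; rewrite ?mulrNz mulr1z tsD ?cls_petal //.
  by apply: tsN; apply: cls_petal.
have nxtN s a : a.2 = false -> nxt s a + te a.1 = s.
  by move=> a2; rewrite /nxt sgE a2 mulrNz mulr1z subrK.
have H1P s a : s \in ts ->
   [/\ boundary2 (H1 s a) = l (nxt s a) - l s - l (te a.1) *~ sg a,
       l1norm (H1 s a) <= K &
       pr (H1 s a) *+ size ts = pr (w (nxt s a)) - pr (w s) - pr (w (te a.1)) *~ sg a].
  move=> sT; have nT := nxtT s a sT; move: nT; rewrite /H1 /nxt !sgE.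
  case: a.2; rewrite ?mulrNz !mulr1z => nT.
    have [? ?] := FP s (te a.1) sT (cls_petal _); split=> //.
    by apply: F_split => //; apply: cls_petal.
  have [FE FK] := FP _ (te a.1) nT (cls_petal _).
  split; first by by rewrite raddfN /= FE subrK; freeg_ring.
    by rewrite l1normN.
  rewrite raddfN /= mulNrn F_split ?cls_petal // subrK.
  by rewrite !opprB opprK addrC.
have HP p s : s \in ts -> let t := s + \sum_(a <- p) te a.1 *~ sg a in
   [/\ t \in ts, boundary2 (H s p) = l t - l s - \sum_(a <- p) l (te a.1) *~ sg a,
       l1norm (H s p) <= K *+ size p &
       pr (H s p) *+ size ts = pr (w t) - pr (w s) - \sum_(a <- p) pr (w (te a.1)) *~ sg a].
  elim: p s => [|a p IH] s sT /=.
    by rewrite !big_nil !addr0 !subr0 !subrr !raddf0 l1norm0 mul0rn.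
  have [E1 N1 Q1'] := H1P s a sT; have [T2 E2 N2 Q2'] := IH _ (nxtT s a sT).
  rewrite !big_cons addrA -/(nxt s a); split=> //.
  - by rewrite raddfD /= E1 E2; freeg_ring.
  - by apply: le_trans (l1normD _ _) _; rewrite mulrS lerD.
  - by rewrite raddfD /= mulrnDl Q1' Q2' addrB_telescope.
have petal_walk x p y : cwalk X x p y ->
    \sum_(a <- p) petal a.1 *~ sg a = P x + walk_chain p - P y.
  elim: p x => [|a p IH] x /=.
    by move=> /eqP ->; rewrite /walk_chain !big_nil addr0 subrr.
  move=> /andP[/eqP <- /IH {}IH]; rewrite /walk_chain !big_cons IH.
  rewrite freegU_scale -[letter_sign a]/(sg a) sgE /petal /lsrc /ltgt.
  case: a.2; rewrite ?mulrNz !mulr1z /walk_chain; freeg_ring.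
(* [W e] is the contribution of one edge: [size ts] times a face is congruent to the linear
   extension of [W] evaluated on its boundary. For a 2-cycle that boundary is 0. *)
pose W e := D e *+ size ts + w (te e).
have face_W f : pr << f >> *+ size ts = pr (fglift W (boundary_face f)).
  have Pf := petal_walk _ _ _ (bnd_walk f).
  (* The petals along the boundary telescope to the boundary chain itself, whose class is zero; thus
     [H] runs from 0 back to 0. *)
  have end0 : \sum_(a <- bnd f) te a.1 *~ sg a = 0.
    have := congr1 cls Pf; rewrite addrAC subrr add0r raddf_sum /=.
    rewrite [RHS](_ : _ = 0); last first.
      by apply/homology_class0P; exists << f >>; rewrite // boundary2U.
    by move=> H0; apply: etrans H0; apply: eq_bigr => a _; rewrite raddfMz.
  have [_] := HP (bnd f) 0 ts0; rewrite end0 addr0 => HE HK HQ.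
  pose Df := \sum_(a <- bnd f) D a.1 *~ sg a.
  have DfE : boundary2 Df = boundary_face f - \sum_(a <- bnd f) l (te a.1) *~ sg a.
    rewrite raddf_sum /=; have -> : boundary_face f = \sum_(a <- bnd f) petal a.1 *~ sg a.
      by rewrite Pf addrAC subrr add0r.
    by rewrite -sumrB; apply: eq_bigr => a _; rewrite raddfMz /= (DP _).1 mulrzBl.
  have DfK : l1norm Df <= K *+ size (bnd f).
    apply: le_trans (l1norm_sum _ _) _; rewrite -sumr_seq_const.
    apply: ler_sum => a _; rewrite sgE; case: a.2; rewrite ?mulrNz mulr1z ?l1normN.
      exact: (DP _).2.
    exact: (DP _).2.
  (* The filling [Df] reduces the face to the short representatives and [H 0 (bnd f)] cancels these,
     leaving a cycle of norm at most [1 + m K + m K]. *)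
  have /(congr1 (fun x => x *+ size ts)) : pr (<< f >> - Df + H 0 (bnd f)) = 0.
    apply: smallP; first by rewrite raddfD raddfB /= boundary2U DfE HE; freeg_ring.
    have Km : K *+ size (bnd f) <= K *+ m by rewrite ler_wpMn2l.
    apply: le_trans (l1normD _ _) _; rewrite mul2n -addnn mulrnDr addrA lerD //.
      apply: le_trans (l1normB _ _) _; rewrite l1normU lerD //.
      exact: le_trans DfK Km.
    exact: le_trans HK Km.
  rewrite mul0rn raddfD raddfB /= mulrnDl mulrnBl HQ subrr sub0r => /eqP.
  rewrite -addrA -opprD subr_eq0 => /eqP ->.
  rewrite /boundary_face /Df !raddf_sum /= -sumrMnl -big_split /=.
  apply: eq_bigr => a _; rewrite freegU_scale -[(-1) ^+ _]/(sg a).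
  by rewrite !raddfMz /= liftU scale1r raddfD raddfMn mulrzDl !pmulrn mulrzAC.
have all_W B : pr B *+ size ts = pr (fglift W (boundary2 B)).
  elim/freeg_ind: B => [|x y Hx Hy|f]; first by rewrite !raddf0 mul0rn.
    by rewrite !raddfB /= mulrnBl Hx Hy.
  by rewrite boundary2U.
move=> A0; apply/zproj_eq0; rewrite raddfMn /= all_W A0 !raddf0 //.
Qed.

End SmallCycles.

(** * Lifting walks to the cover *)

Section CoverChains.
Context (X : complex) (x0 : vert X) (N : subgroup (pi1 x0)).
Local Notation letter := (edge X * bool)%type.
Local Notation pi1 := (pi1 x0).
Local Notation uvert := (uvert x0).
Local Notation Y := (cover_of x0 N).
Local Notation ext := (@extend X x0).
Local Notation qv := (\pi_(qvert (deck_action x0) N)).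
Local Notation qe := (\pi_(qedge (deck_action x0) N)).
Local Notation qf := (\pi_(qface (deck_action x0) N)).
Local Notation cls := (@homology_class Y).

Lemma uproj_foldl v p y : cwalk X (uproj v) p y -> uproj (foldl ext v p) = y.
Proof.
elim: p v => [|a p IH] v /=; first by move=> /eqP.
by move=> /andP[/eqP ea wp]; apply: IH; rewrite uproj_extend.
Qed.

Lemma ulift_cat v p q : ulift v (p ++ q) = ulift v p ++ ulift (foldl ext v p) q.
Proof. by elim: p v => // a p IH v /=; case: insub => [e|]; rewrite IH. Qed.

Lemma qvP v w : qv v = qv w <-> exists2 n, (N : set pi1) n & deckv n v = w.
Proof. by split=> [/eqmodP/asboolP|H]; last exact/eqmodP/asboolP. Qed.

Lemma qe_decke n e : (N : set pi1) n -> qe (decke n e) = qe e.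
Proof. by move=> Nn; apply/esym/eqmodP/asboolP; exists n. Qed.

Definition lift_chain (v : uvert) (p : seq letter) : chain1 Y :=
  walk_chain (X := Y) [seq (qe a.1, a.2) | a <- ulift v p].

Lemma lift_chain_cat v p q :
  lift_chain v (p ++ q) = lift_chain v p + lift_chain (foldl ext v p) q.
Proof. by rewrite /lift_chain ulift_cat map_cat walk_chain_cat. Qed.

Lemma lift_chain_deck n v p y : (N : set pi1) n -> cwalk X (uproj v) p y ->
  lift_chain (deckv n v) p = lift_chain v p.
Proof.
move=> Nn wp; rewrite /lift_chain (deck_ulift n wp) -map_comp.
by congr walk_chain; apply: eq_map => a /=; rewrite qe_decke.
Qed.

Lemma l1norm_lift_chain v p y : cwalk X (uproj v) p y ->
  l1norm (lift_chain v p) <= (size p)%:Z.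
Proof.
by move=> wp; apply: le_trans (l1norm_walk_chain _) _; rewrite size_map (size_ulift wp).
Qed.

Lemma lift_chain_spur v a : lsrc (@src X) (@tgt X) a = uproj v ->
  lift_chain v [:: a; linv a] = 0.
Proof.
move=> ea; rewrite /lift_chain.
have [e ve ->] := ulift_cons [:: linv a] ea.
have [e' ve' ->] : exists2 e' : uedge x0,
    val e' = (if (linv a).2 then ext v a else ext (ext v a) (linv a), (linv a).1) &
    ulift (ext v a) [:: linv a] = (e', (linv a).2) :: ulift (ext (ext v a) (linv a)) [::].
  by apply: ulift_cons; rewrite lsrc_inv uproj_extend.
have -> : e' = e.
  by apply: val_inj; rewrite ve ve' extendK //; case: (a) => ? [].
rewrite /= /walk_chain !big_cons big_nil /letter_sign /= addr0.
by case: a.2; rewrite freegUD ?subrr ?addNr freegU0.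
Qed.

Lemma qbnd_pi (f : uface x0) : bnd (qf f : face Y) = [seq (qe a.1, a.2) | a <- ubnd f].
Proof.
have /eqmodP/asboolP[n Nn En] : qf f = qf (repr (qf f)) by rewrite reprK.
transitivity [seq (qe a.1, a.2) | a <- ubnd (repr (qf f))] => //.
rewrite -En deck_bnd -map_comp.
by apply: eq_map => a /=; rewrite qe_decke.
Qed.

Lemma lift_chain_bnd v f : uproj v = base f ->
  exists F : face Y, lift_chain v (bnd f) = boundary_face F.
Proof.
move=> ev; have vf : uproj (v, f).1 == base (v, f).2 by apply/eqP.
by exists (qf (exist _ (v, f) vf)); rewrite /boundary_face qbnd_pi.
Qed.

(** An elementary homotopy deletes a subpath whose lift returns to its starting point, so the rest
    lifts unchanged. The deleted part has chain 0 for a backtrack and the boundary of a face of the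
    cover otherwise. *)
Lemma cls_homotopic v x y p q : uproj v = x -> homotopic x y p q ->
  cls (lift_chain v p) = cls (lift_chain v q).
Proof.
move=> vx; elim=> {p q} [p q [wp wq s]|p|p q _ ->|p q r _ -> _ ->] //.
have [u [r [w [-> -> r0 rC]]]] : exists u r w,
    [/\ p = u ++ r ++ w, q = u ++ w, foldl ext (foldl ext v u) r = foldl ext v u
      & cls (lift_chain (foldl ext v u) r) = 0].
  case: s wp wq => [u a w|u f w] wp wq.
    exists u, [:: a; linv a], w; split=> //.
      move: wp => /walk_catE[z wu /= /and3P[/eqP ea _ _]].
      by rewrite /= extendK // ea (uproj_foldl (y := z)) // vx.
    move: wp => /walk_catE[z wu /= /and3P[/eqP ea _ _]].
    by rewrite lift_chain_spur ?raddf0 // ea (uproj_foldl (y := z)) // vx.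
  exists u, (bnd f), w; move: wp => /walk_catE[z wu /walk_catE[z' wf _]].
  have zf : z = base f.
    move: wf (bnd_walk f); case: (bnd f) (bnd_size f) => // a b _ /=.
    by move=> /andP[/eqP <- _] /andP[/eqP <- _].
  have uf : uproj (foldl ext v u) = base f by rewrite (uproj_foldl (y := z)) // vx.
  split=> //; first by rewrite extend_bnd.
  have [F ->] := lift_chain_bnd uf.
  by apply/homology_class0P; exists << F >>; rewrite // boundary2U.
by rewrite !lift_chain_cat !raddfD /= rC add0r r0.
Qed.

Definition uvert0 : uvert := \pi_uvert (Upath (X := X) (x0 := x0) (p := [::]) (eqxx x0)).

Lemma uproj_uvert0 : uproj uvert0 = x0.
Proof. exact: uproj_pi. Qed.

Lemma foldl_uvert0 p y (w : cwalk X x0 p y) : foldl ext uvert0 p = \pi_uvert (Upath w).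
Proof.
rewrite /uvert0 (extend_walk (p := Upath _) w).
by apply/uvert_piP; split=> //; apply: homotopic_refl.
Qed.

Lemma deckv_uvert0 g : deckv g uvert0 = foldl ext uvert0 (val (repr g)).
Proof.
rewrite -[g in LHS]reprK /uvert0 deckv_pi (foldl_uvert0 (valP (repr g))).
by apply/uvert_piP; split=> //=; rewrite cats0; apply: homotopic_refl.
Qed.

Lemma foldl_homotopic p q y : cwalk X x0 p y -> cwalk X x0 q y ->
  foldl ext uvert0 p = foldl ext uvert0 q <-> homotopic x0 y p q.
Proof.
move=> wp wq; rewrite (foldl_uvert0 wp) (foldl_uvert0 wq); split.
  by move=> /uvert_piP[].
by move=> h; apply/uvert_piP.
Qed.

(** On [N] this is the Hurewicz map of the cover: a loop representing [n] lifts to a closed walk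
    there. *)
Definition holonomy (n : pi1) := cls (lift_chain uvert0 (val (repr n))).

(** The walk [p] and the loop of [n] followed by [q] have lifts with the same endpoint in the
    universal cover, hence are homotopic; translating the lift of [q] by [n] does not change its
    chain in the quotient. *)
Lemma cls_endpoint n p q y : (N : set pi1) n -> cwalk X x0 p y -> cwalk X x0 q y ->
  foldl ext uvert0 p = deckv n (foldl ext uvert0 q) ->
  cls (lift_chain uvert0 p) = holonomy n + cls (lift_chain uvert0 q).
Proof.
move=> Nn wp wq E; have wnq := walk_cat (valP (repr n)) wq.
have /(foldl_homotopic wp wnq) H :
    foldl ext uvert0 p = foldl ext uvert0 (val (repr n) ++ q).
  rewrite E (foldl_uvert0 wq) -[n in LHS]reprK deckv_pi (foldl_uvert0 wnq).
  by apply/uvert_piP; split=> //; apply: homotopic_refl.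
rewrite (cls_homotopic uproj_uvert0 H) lift_chain_cat raddfD /=; congr (_ + cls _).
by rewrite -deckv_uvert0 (lift_chain_deck (y := y)) // uproj_uvert0.
Qed.

Lemma holonomyM m n : (N : set pi1) m -> holonomy (m * n)%g = holonomy m + holonomy n.
Proof.
move=> Nm; rewrite [LHS]/holonomy [holonomy n]/holonomy.
apply: (cls_endpoint Nm (valP (repr (m * n)%g)) (valP (repr n))).
by rewrite -!deckv_uvert0 deckvM.
Qed.

Lemma holonomy1 : holonomy 1%g = 0.
Proof.
by apply: (addIr (holonomy 1%g)); rewrite add0r -holonomyM ?mulg1 //; apply: subgroup1.
Qed.

Lemma holonomyV m : (N : set pi1) m -> holonomy m^-1%g = - holonomy m.
Proof.
move=> Nm; apply: (addrI (holonomy m)).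
by rewrite -holonomyM // mulgV subrr holonomy1.
Qed.

Lemma holonomy_derived g : derived N g -> holonomy g = 0.
Proof.
have K : is_subgroup [set g | (N : set pi1) g /\ holonomy g = 0].
  split=> [|x y [Nx x0'] [Ny y0']|x [Nx x0']] /=.
  - by rewrite holonomy1; split=> //; apply: subgroup1.
  - by rewrite holonomyM // x0' y0' addr0; split=> //; apply: subgroupM.
  - by rewrite holonomyV // x0' oppr0; split=> //; apply: subgroupV.
move=> Ng; suff [] : [set g | (N : set pi1) g /\ holonomy g = 0] g by [].
apply: (@gen_ind _ _ (Subgroup K)) Ng => _ [x [y [Nx Ny ->]]] /=.
have [NVx NVy] := (subgroupV Nx, subgroupV Ny).
rewrite /commg /conjg; split; first by do !apply: subgroupM => //.
by rewrite !holonomyM ?holonomyV //; rewrite addrA -opprD addNr.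
Qed.

Lemma holonomy_lcoset g h : (N : set pi1) g -> lcoset (derived N) g h ->
  (N : set pi1) h /\ holonomy h = holonomy g.
Proof.
move=> Ng [x Nx <-]; split; first by apply: subgroupM => //; apply: derived_sub.
by rewrite holonomyM // (holonomy_derived Nx) addr0.
Qed.

Lemma holonomy_loop (p : loop x0) :
  holonomy (\pi_pi1 p) = cls (lift_chain uvert0 (val p)).
Proof. exact: (cls_homotopic uproj_uvert0 (pi1_repr p)). Qed.

End CoverChains.

(** * Short loops representing cosets *)

Section ShortLoops.
Context (X : complex) (x0 : vert X).
Local Notation pi1 := (pi1 x0).

Lemma size_walk_inv (p : seq (edge X * bool)) : size (walk_inv p) = size p.
Proof. by rewrite /walk_inv size_rev size_map. Qed.

Lemma letters_bounded (S : {fset pi1}) : exists r : nat, forall s : pi1,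
  is_letter S s -> exists2 p : loop x0, s = \pi_pi1 p & (size (val p) <= r)%N.
Proof.
exists (\max_(s <- S) size (val (repr s))) => s sS.
have [t tS [st|st]] : exists2 t, t \in S & s = t \/ s = (t^-1)%g.
  case/orP: sS => sS; first by exists s; [|left].
  by exists (s^-1)%g; [|right; rewrite invgK].
  exists (repr t); first by rewrite reprK.
  exact: (@leq_bigmax_seq _ _ xpredT (fun s : pi1 => size (val (repr s))) t tS isT).
exists (loop_inv (repr t)); first by [].
rewrite /= size_walk_inv.
exact: (@leq_bigmax_seq _ _ xpredT (fun s : pi1 => size (val (repr s))) t tS isT).
Qed.

Lemma word_loop (S : {fset pi1}) r (w : seq pi1) :
  (forall s : pi1, is_letter S s ->
     exists2 p : loop x0, s = \pi_pi1 p & (size (val p) <= r)%N) ->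
  all (is_letter S) w -> exists2 p : loop x0,
    (\prod_(s <- w) s)%g = \pi_pi1 p & (size (val p) <= r * size w)%N.
Proof.
move=> Sr; elim: w => [|s w IH] /=; first by exists (loop1 x0); rewrite ?big_nil.
move=> /andP[/Sr[p -> pr] /IH[q qE qr]]; exists (loop_mul p q).
  by rewrite big_cons qE; apply: pi1_mul_pi.
by rewrite /= size_cat mulnS leq_add.
Qed.

(** A diameter bound for the cosets, measured in edges of the complex rather than in letters of a
    generating set. *)
Definition short_reps (H : set pi1) (k : nat) := forall g : pi1,
  exists2 p : loop x0, lcoset H g (\pi_pi1 p) & (size (val p) <= k)%N.

Lemma short_repsS (H K : set pi1) k : H `<=` K -> short_reps H k -> short_reps K k.
Proof.
move=> HK sH g; have [p [h Hh E] pk] := sH g.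
by exists p => //; exists h => //; apply: HK.
Qed.

End ShortLoops.

(** * Cells of the cover *)

Section CoverGeometry.
Context (X : complex) (x0 : vert X) (N : subgroup (pi1 x0)).
Local Notation letter := (edge X * bool)%type.
Local Notation pi1 := (pi1 x0).
Local Notation uvert := (uvert x0).
Local Notation Y := (cover_of x0 N).
Local Notation ext := (@extend X x0).
Local Notation qv := (\pi_(qvert (deck_action x0) N)).
Local Notation qe := (\pi_(qedge (deck_action x0) N)).
Local Notation qf := (\pi_(qface (deck_action x0) N)).
Local Notation cls := (@homology_class Y).
Local Notation v0 := (@uvert0 X x0).
Hypothesis nN : normal_set N.
Context (way : vert X -> seq letter) (Q : nat).
Hypothesis way_walk : forall y, cwalk X x0 (way y) y.
Hypothesis way_size : forall y, (size (way y) <= Q)%N.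

(** The deck transformation is the class of a path representing [w] followed by the reversed
    [way]. *)
Lemma uvert_deck_way (w : uvert) : exists g, w = deckv g (foldl ext v0 (way (uproj w))).
Proof.
have wr := valP (repr w); have wi := walk_rev (way_walk (uproj w)).
have wl := walk_cat wr wi.
exists (\pi_pi1 (exist (fun p => cwalk X x0 p x0 : Prop) _ wl : loop x0)).
rewrite (foldl_uvert0 (way_walk _)) deckv_pi.
rewrite -[LHS]reprK; apply/uvert_piP => /=; split=> //.
apply: homotopic_sym; rewrite -catA -/(uproj w).
have := homotopic_cat wr (walk_cat wi (way_walk (uproj w))) (homotopic_refl _ _ _)
  (homotopic_Vmul (way_walk (uproj w))).
by rewrite cats0.
Qed.

Lemma normal_lcosetC g h : lcoset N g h -> exists2 n, (N : set pi1) n & g = (n * h)%g.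
Proof.
move=> [n Nn <-]; exists (g * n^-1 * g^-1)%g.
  have := nN (g^-1)%g (subgroupV Nn); by rewrite /conjg invgK mulgA.
by rewrite !mulgA mulgVK mulgVK.
Qed.

(** A lift of [v] is a translate by some [g] of the endpoint of a [way]. Normality turns a short
    representative of the left coset of [g] into one modulo the left action of [N]. *)
Lemma cover_vertex k : short_reps N k -> forall v : vert Y,
  exists p y, [/\ cwalk X x0 p y, (size p <= k + Q)%N & qv (foldl ext v0 p) = v].
Proof.
move=> sN v; have [g wE] := uvert_deck_way (repr v).
set y := uproj (repr v) in wE.
have [p /normal_lcosetC[n Nn gE] pk] := sN g.
have wy := way_walk y; have wp := walk_cat (valP p) wy.
exists (val p ++ way y), y; split=> //.
  by rewrite size_cat leq_add.
rewrite -[RHS]reprK wE gE deckvM; apply/qvP; exists n => //; congr deckv.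
rewrite (foldl_uvert0 wy) deckv_pi (foldl_uvert0 wp).
by apply/uvert_piP; split=> //; apply: homotopic_refl.
Qed.

Definition lift_face (w : uvert) (f : face X) (wf : uproj w == base f) : uface x0 :=
  exist _ (w, f) wf.

(** Pairs of a coset of [N] and a face of [X] exhaust the faces of the cover. *)
Lemma cover_face_finite : finite_index N -> finite_set [set: face X] ->
  finite_set [set: face Y].
Proof.
move=> finN finF.
have /boolp.choice[r rP] : forall A : set pi1, exists g, cosets N A -> lcoset N g = A.
  by move=> A; case: (pselect (cosets N A)) => [[g _ <-]|nA]; [exists g|exists 1%g].
have lf g f : uproj (deckv g (foldl ext v0 (way (base f)))) == base f.
  by rewrite /= uproj_deck (uproj_foldl (y := base f)) // uproj_uvert0.
pose phi (Af : set pi1 * face X) : face Y := qf (lift_face (lf (r Af.1) Af.2)).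
have finX : finite_set (cosets N `*` [set: face X]) by apply: finite_setX.
apply: sub_finite_set (finite_image phi finX) => F _ /=.
have [g wE] := uvert_deck_way (val (repr F)).1.
have fE := eqP (valP (repr F)); rewrite fE in wE.
have cg : cosets N (lcoset N g) by exists g.
have /lcoset_eqP Nn := rP _ cg.
exists (lcoset N g, (val (repr F)).2); first by split.
rewrite -[RHS]reprK; apply/eqmodP/asboolP.
have [n Nn' gE] : exists2 n, (N : set pi1) n & g = (n * r (lcoset N g))%g.
  by apply: normal_lcosetC; have := lcoset_id N (r (lcoset N g)); rewrite (rP _ cg).
exists n => //; apply: val_inj => /=; rewrite -deckvM -gE -wE.
exact/esym/surjective_pairing.
Qed.

Lemma size_cover_bnd (F : face Y) : exists f : face X, size (bnd F) = size (bnd f).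
Proof.
exists (val (repr F)).2; rewrite /= size_map (size_ulift (y := base (val (repr F)).2)) //.
by rewrite (eqP (valP (repr F))); apply: bnd_walk.
Qed.

(** The walk to the source of [E] extended by [E], and the walk to its target, end over the same
    vertex of the cover. Their lifts thus end at points differing by an element of [N], and
    [cls_endpoint] gives the class. *)
Lemma cls_petal (P : vert Y -> seq letter) (yP : vert Y -> vert X) :
  (forall v, cwalk X x0 (P v) (yP v)) ->
  (forall v, qv (foldl ext v0 (P v)) = v) ->
  forall E : edge Y, exists2 n, (N : set pi1) n &
    cls (petal (fun v => lift_chain N v0 (P v)) E) = holonomy N n.
Proof.
move=> wP PE E; set u := foldl ext v0 (P (src E)).
have /qvP[n Nn uE] : qv (val (repr E)).1 = qv u by rewrite PE.
(* [e'] is the lift of [E] that starts where the lifted walk to its source ends. *)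
pose e' := decke n (repr E); have E' : qe e' = E by rewrite qe_decke ?reprK.
have ve' : val e' = (u, (val (repr E)).2) by rewrite /= uE.
set e := (val (repr E)).2 in ve'.
have ue : uproj u = src e by rewrite -uE uproj_deck (eqP (valP (repr E))).
have we : cwalk X x0 (rcons (P (src E)) (e, true)) (tgt e).
  have yE : yP (src E) = src e.
    by rewrite -ue /u (uproj_foldl (y := yP (src E))) // uproj_uvert0.
  by rewrite -cats1; apply: walk_cat (wP _) _; rewrite /= yE !eqxx.
have tE : qv (ext u (e, true)) = tgt E.
  rewrite -E'; apply: etrans (esym (qtgt_pi (deck_action x0) N e')).
  by rewrite /= /utgt ve'.
have /esym/qvP[m Nm mE] : qv (ext u (e, true)) = qv (foldl ext v0 (P (tgt E))).
  by rewrite tE PE.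
exists m => //.
have yE : yP (tgt E) = tgt e.
  have := congr1 (@uproj X x0) mE.
  by rewrite uproj_deck (uproj_foldl (y := yP (tgt E))) ?uproj_uvert0 // uproj_extend.
have := wP (tgt E); rewrite yE => wtE.
have := cls_endpoint Nm we wtE; rewrite foldl_rcons -/u => /(_ (esym mE)).
rewrite -cats1 lift_chain_cat -/u.
have [e1 ve1 E1] := ulift_cons (a := (e, true)) [::] (esym ue).
have -> : lift_chain N u [:: (e, true)] = << E >>.
  rewrite /lift_chain E1 /= /walk_chain big_seq1 /letter_sign /= expr0.
  by rewrite (_ : e1 = e') ?E' //; apply: val_inj; rewrite ve1 ve'.
by rewrite /petal raddfB /= => ->; rewrite addrK.
Qed.

End CoverGeometry.

(** * The invariants of the cover *)

(** Instantiates [small_cycles_span] with [L = k + Q + 1]: petals have norm at most [2 (k + Q) + 1],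
    and the multiplier [M] is the order of the holonomy image. *)
Lemma cover_span (X : complex) (x0 : vert X) (N : subgroup (pi1 x0))
    (way : vert X -> seq (edge X * bool)) (Q k m : nat) (K : int) :
  normal_set N -> finite_set (abelianization N) ->
  (forall y, cwalk X x0 (way y) y) -> (forall y, (size (way y) <= Q)%N) ->
  short_reps (derived N) k ->
  (2 <= m)%N -> (forall f : face X, (size (bnd f) <= m)%N) -> 0 <= K ->
  (forall z, range (@boundary2 (cover_of x0 N)) z -> l1norm z <= (k + Q).+1%:Z *+ 3 ->
     exists2 A, boundary2 A = z & l1norm A <= K) ->
  forall A, H2 (cover_of x0 N) A -> exists2 M : nat, M != 0%N &
    zgen (small_cycles K m) (A *+ M).
Proof.
move=> nN finT wayP wayQ sD m2 bm K0 fillK A A0.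
have sN : short_reps N k by apply: short_repsS sD; apply: derived_sub.
have /boolp.choice[PW PWP] v : exists py : seq (edge X * bool) * vert X,
    [/\ cwalk X x0 py.1 py.2, (size py.1 <= k + Q)%N &
        \pi_(qvert (deck_action x0) N) (foldl (@extend X x0) (@uvert0 X x0) py.1) = v].
  by have [p [y [? ? ?]]] := cover_vertex nN wayP wayQ sN v; exists (p, y).
pose P v := lift_chain N (@uvert0 X x0) (PW v).1.
have normP v : l1norm (P v) <= (k + Q)%:Z.
  have [wp sp _] := PWP v.
  by apply: le_trans (l1norm_lift_chain _ _) _; [rewrite uproj_uvert0; exact: wp|].
have /boolp.choice[rep repP] : forall B : set (pi1 x0), exists g,
    abelianization N B -> (N : set (pi1 x0)) g /\ lcoset (derived N) g = B.
  move=> B; case: (pselect (abelianization N B)) => [[g Ng <-]|nB]; first by exists g.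
  by exists 1%g.
(* Holonomy is constant on cosets of the derived subgroup, so representatives of the finite
   abelianization list its whole image. *)
pose ts := undup [seq holonomy N (rep B) | B <- fset_set (abelianization N)].
have tsP t : t \in ts <-> exists2 g, (N : set (pi1 x0)) g & holonomy N g = t.
  rewrite mem_undup; split=> [/mapP[B]|[g Ng <-]].
    rewrite in_fset_set // => /set_mem/repP[NB _] ->.
    by exists (rep B).
  have aB : abelianization N (lcoset (derived N) g) by exists g.
  have [NB E] := repP _ aB; apply/mapP; exists (lcoset (derived N) g).
    by rewrite in_fset_set //; apply/mem_set.
  have gB : lcoset (derived N) (rep (lcoset (derived N) g)) g.
    by rewrite E; apply: (lcoset_id (derived_subgroup N)).
  by have [_ ->] := holonomy_lcoset NB gB.
have /boolp.choice[l lP] : forall t, exists z, t \in ts ->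
    homology_class z = t /\ l1norm z <= k%:Z.
  move=> t; case: (boolP (t \in ts)) => [/tsP[g Ng gt]|nt]; last by exists 0.
  have [p gp pk] := sD g; exists (lift_chain N (@uvert0 X x0) (val p)) => _.
  have [Np hp] := holonomy_lcoset Ng gp.
  rewrite -gt -hp holonomy_loop; split=> //.
  apply: (@le_trans _ _ (size (val p))%:Z); last by rewrite lez_nat.
  by apply: (@l1norm_lift_chain _ _ _ _ _ x0); rewrite uproj_uvert0; apply: (valP p).
have ts0 : 0 \in ts by apply/tsP; exists 1%g; [exact: subgroup1|exact: holonomy1].
exists (size ts); first by rewrite size_eq0; apply: contraTneq ts0 => ->.
apply: (@small_cycles_span (cover_of x0 N) P ts l (k + Q).+1%:Z K m) => //.
- exact: undup_uniq.
- move=> _ _ /tsP[g Ng <-] /tsP[h Nh <-]; apply/tsP.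
  by exists (g * h)%g; [exact: subgroupM|rewrite holonomyM].
- by move=> t /lP[].
- move=> t /lP[_ tk]; apply: le_trans tk _; rewrite lez_nat; exact: leqW (leq_addr _ _).
- move=> e; apply/tsP.
  have [||n Nn ->] := @cls_petal _ _ N (fun v => (PW v).1) (fun v => (PW v).2) _ _ e.
  + by move=> v; have [] := PWP v.
  + by move=> v; have [] := PWP v.
  + by exists n.
- move=> e; rewrite /petal; apply: le_trans (l1normB _ _) _.
  apply: le_trans (lerD (l1normD _ _) (normP _)) _; rewrite l1normU.
  apply: le_trans (_ : (k + Q)%:Z + 1 + (k + Q)%:Z <= _).
    by rewrite lerD2r lerD2r.
  by rewrite mulr2n; lia.
- by move=> F; have [f ->] := size_cover_bnd F.
Qed.

(** * Fillings and the invariants [rho1] and [xi2] *)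

Section Filling.
Context (R : realType) (X : complex).
Implicit Types (z : chain1 X).

(** Norms of integral chains are natural numbers, so the infimum is a minimum. *)
Lemma fill1_attained z : range (@boundary2 X) z ->
  exists2 A, boundary2 A = z & fill1 R z = (l1norm A)%:~R.
Proof.
move=> [A0 _ A0z].
pose p n := `[< exists2 A, boundary2 A = z & l1norm A = n%:Z >].
have normZ (A : chain2 X) : l1norm A = `|l1norm A|%N%:Z.
  by rewrite gez0_abs // l1norm_ge0.
have pe : exists n, p n by exists `|l1norm A0|%N; apply/asboolP; exists A0.
case: (ex_minnP pe) => n /asboolP[A Az An] nmin; exists A => //.
have lb : lbound [set (l1norm B)%:~R | B in [set B : chain2 X | boundary2 B = z]]
    ((l1norm A)%:~R : R).
  move=> _ [B Bz <-]; rewrite ler_int An normZ lez_nat; apply: nmin.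
  by apply/asboolP; exists B.
apply/eqP; rewrite eq_le; apply/andP; split.
  by apply: ge_inf; [exists (l1norm A)%:~R|exists A].
by apply: lb_le_inf => //; exists (l1norm A)%:~R; exists A.
Qed.

Lemma fill1_ge1 z : range (@boundary2 X) z -> z != 0 -> 1 <= fill1 R z.
Proof.
move=> /fill1_attained[A Az ->] z0; rewrite ler1z l1norm_ge1 //.
by apply: contra_neq z0 => A0; rewrite -Az A0 raddf0.
Qed.

Lemma rho1_ge0 : (0 <= rho1 R X)%E.
Proof.
apply: le_ereal_inf_tmp => _ [z [z0 zB] <-]; rewrite lee_fin divr_ge0 //.
  by rewrite ler0z l1norm_ge0.
exact: le_trans (fill1_ge1 zB z0).
Qed.

Lemma rho1_le z : range (@boundary2 X) z -> z != 0 ->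
  (rho1 R X <= ((l1norm z)%:~R / fill1 R z)%:E)%E.
Proof. by move=> zB z0; apply: ereal_inf_lbound; exists z. Qed.

Lemma rho1_fill (r : R) z : 0 < r -> (r%:E <= rho1 R X)%E -> range (@boundary2 X) z ->
  exists2 A, boundary2 A = z & (l1norm A)%:~R <= (l1norm z)%:~R / r.
Proof.
move=> r0 rr zB; have [z0|z0] := eqVneq z 0.
  by exists 0; rewrite z0 ?raddf0 // !l1norm0 mul0r.
have [A Az AE] := fill1_attained zB; exists A => //; rewrite -AE.
have := le_trans rr (rho1_le zB z0); rewrite lee_fin.
have f0 : 0 < fill1 R z := lt_le_trans ltr01 (fill1_ge1 zB z0).
by rewrite ler_pdivlMr // mulrC -ler_pdivlMr.
Qed.

Lemma rho1_pinfty z : rho1 R X = +oo%E -> range (@boundary2 X) z -> z = 0.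
Proof.
move=> ry zB; apply/eqP/contraT => z0.
by have := rho1_le zB z0; rewrite ry.
Qed.

(** A nonzero face boundary has norm at most [m] and filling norm at least 1. If all face boundaries
    vanish, so do all exact cycles, and the infimum is over the empty set. *)
Lemma rho1_le_bnd (m : nat) : (forall f : face X, (size (bnd f) <= m)%N) ->
  rho1 R X <> +oo%E -> (rho1 R X <= m%:R%:E)%E.
Proof.
move=> bm ny.
have [[f f0]|nf] := pselect (exists f, boundary_face f != 0 :> chain1 X).
  have fB : range (@boundary2 X) (boundary_face f) by exists << f >>; rewrite ?boundary2U.
  apply: le_trans (rho1_le fB f0) _; rewrite lee_fin ler_pdivrMr; last first.
    exact: lt_le_trans ltr01 (fill1_ge1 fB f0).
  apply: (@le_trans _ _ m%:R); last by rewrite ler_peMr // fill1_ge1.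
  rewrite -[m%:R]/(m%:Z%:~R) ler_int; apply: le_trans (l1norm_walk_chain _) _.
  by rewrite lez_nat.
exfalso; apply: ny; rewrite /rho1; set S := (X in ereal_inf X).
suff -> : S = set0 by rewrite ereal_inf0.
rewrite -subset0 => r [z [/eqP z0 [A _ Az]] rE]; apply: z0; rewrite -Az.
clear rE; elim/freeg_ind: A {Az} => [|x y Hx Hy|f]; first by rewrite raddf0.
  by rewrite raddfB /= Hx Hy subrr.
rewrite boundary2U; apply/eqP/contraT => f0; case: nf; by exists f.
Qed.

Lemma chain2_zindep_le : finite_set [set: face X] -> exists b : nat,
  forall m (S : 'I_m -> chain2 X), zindep S -> (m <= b)%N.
Proof.
move=> finF; pose s := fset_set [set: face X]; exists (size s) => m S indS.
pose T (j : 'I_(size s)) : chain2 X := << tnth (in_tuple s) j >>.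
apply: (@zindep_le _ _ _ T S) => // i; exists 1 => //; rewrite mulr1z.
elim/freeg_ind: (S i) => [|x y [c ->] [d ->]|f].
- by exists (fun=> 0); rewrite big1.
- exists (fun j => c j - d j); rewrite -sumrB; apply: eq_bigr => j _.
  by rewrite mulrzBr.
have fs : f \in in_tuple s by rewrite in_fset_set //; apply/mem_set.
have /tnthP[j fE] := fs; exists (fun h => (h == j)%:Z).
rewrite (bigD1 j) //= eqxx mulr1z /T -fE big1 ?addr0 // => h /negbTE ->.
exact: mulr0z.
Qed.

(** A maximal independent family of cycles of norm at most [B] has as many members as the rank of
    [H2 X], so it competes in the infimum. *)
Lemma xi2_le (B : int) : finite_set [set: face X] -> 0 <= B ->
  (forall A, H2 X A -> exists2 M : nat, M != 0%N &
     zgen [set S | H2 X S /\ l1norm S <= B] (A *+ M)) ->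
  (xi2 R X <= B%:~R%:E)%E.
Proof.
move=> finF B0 span; rewrite /xi2; case: asboolP => [_|_].
  by rewrite lee_fin ler0z.
have [d dP] := chain2_zindep_le finF.
have [b [S [SP indS maxS]]] := @maximal_zindep _ [set S | H2 X S /\ l1norm S <= B] d
  (fun m S _ indS => dP m S indS).
have H2S A : H2 X A -> exists2 k : int, k != 0 & zspan S (A *~ k).
  move=> /span[M M0 /(zgen_zspan maxS)[k k0 kS]]; exists (M%:Z * k).
    by rewrite mulf_neq0.
  by rewrite mulrzA -pmulrn.
apply: ereal_inf_le; last first.
  exists (\big[Num.max/0]_(j < b) (l1norm (S j))%:~R)%:E.
    exists b, S; split=> //.
    - split; first by exists S => // j; have [] := SP j.
      move=> m S' HS' indS'; apply: (zindep_le (S := S) indS') => i.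
      exact: H2S.
    - by move=> j; have [] := SP j.
    - split; first exists S => // j.
        exists (fun h => (h == j)%:Z); rewrite (bigD1 j) //= eqxx mulr1z.
        by rewrite big1 ?addr0 // => h /negbTE ->; exact: mulr0z.
      move=> m S' HS' indS'; apply: (zindep_le (S := S) indS') => i.
      by exists 1; rewrite ?mulr1z.
  rewrite lee_fin; apply: bigmax_le; first by rewrite ler0z.
  by move=> j _; rewrite ler_int; have [] := SP j.
Qed.

Lemma xi2_ge0 : (0 <= xi2 R X)%E.
Proof.
rewrite /xi2; case: asboolP => // _.
apply: le_ereal_inf_tmp => _ [b [S [_ _ _ ->]]]; rewrite lee_fin.
by apply: le_trans (bigmax_ge_id _ _ _ _).
Qed.

End Filling.

(** * From the spectral gap to the inequality for one cover *)

Lemma coset_index_gt0 (G : groupType) (H : subgroup G) :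
  finite_index H -> (0 < coset_index H)%N.
Proof.
move=> finH; rewrite cardfs_gt0; apply/fset0Pn; exists (lcoset H 1%g).
by rewrite in_fset_set //; apply/mem_set; exists 1%g.
Qed.

Lemma card_abelianization_gt0 (G : groupType) (H : subgroup G) :
  finite_set (abelianization H) -> (0 < #|` fset_set (abelianization H)|)%N.
Proof.
move=> finT; rewrite cardfs_gt0; apply/fset0Pn; exists (lcoset (derived H) 1%g).
by rewrite in_fset_set //; apply/mem_set; exists 1%g => //; apply: subgroup1.
Qed.

(** Words of length [j], of order [log n / c], reach every coset because
    [n (1 - c)^j <= n exp(- c j) < 1]; replacing each letter by a loop of length at most [r] costs a
    factor [r]. *)
Lemma tau_short_reps (R : realType) (X : complex) (x0 : vert X) :
  property_tau R (pi1 x0) -> exists2 a : R, 0 <= a &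
  forall H : subgroup (pi1 x0), normal_set H -> finite_index H ->
    exists2 k, short_reps H k & k%:R <= a * (1 + ln (coset_index H)%:R).
Proof.
move=> [S [_ [eps eps0 gap]]]; have [r Sr] := letters_bounded S.
set t : R := (2 * (2 * #|` S|))%:R + eps; have t0 : 0 < t by rewrite ltr_wpDl.
set c := eps / t; have c0 : 0 < c by rewrite divr_gt0.
exists (r%:R * (c^-1 + 1)); first by rewrite mulr_ge0 // addr_ge0 // invr_ge0 ltW.
move=> H nH finH; set n := coset_index H.
have n1 : 1 <= n%:R :> R by rewrite ler1n coset_index_gt0.
have ln0 : 0 <= ln n%:R :> R by rewrite ln_ge0.
(* The successor makes [c j] strictly larger than [log n]. *)
pose j := (Num.truncn (ln n%:R / c)).+1.
have /truncn_itv/andP[jle' jgt] : 0 <= ln n%:R / c by rewrite divr_ge0 // ltW.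
have jle : j%:R <= ln n%:R / c + 1 by rewrite -natr1 lerD2r.
have nj : n%:R * (1 - c) ^+ j < 1.
  apply: (@le_lt_trans _ _ (n%:R * expR (- c) ^+ j)).
    rewrite ler_wpM2l // lerXn2r ?nnegrE ?expR_ge0 ?expR_ge1Dx //.
    by rewrite subr_ge0 ler_pdivrMr // mul1r lerDr.
  rewrite -expRM_natl -[n%:R]lnK ?posrE ?(lt_le_trans ltr01) // -expRD.
  rewrite -[X in _ < X]expR0 ltr_expR.
  by rewrite mulrN subr_lt0 -ltr_pdivrMr.
exists (r * j)%N.
  move=> g; have [w [Sw wj gw]] := gap_word finH eps0 (gap H nH finH) nj g.
  have [p pE pr] := word_loop Sr Sw; exists p; first by rewrite -pE.
  by apply: leq_trans pr _; rewrite leq_mul2l wj orbT.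
rewrite natrM -mulrA ler_wpM2l //; apply: le_trans jle _.
have -> : (c^-1 + 1) * (1 + ln n%:R) = ln n%:R / c + 1 + (c^-1 + ln n%:R) by ring.
by rewrite lerDl addr_ge0 // invr_ge0 ltW.
Qed.

Lemma finite_seq_bound (T : choiceType) (f : T -> nat) : finite_set [set: T] ->
  exists m, forall x, (f x <= m)%N.
Proof.
move=> finT; exists (\max_(x <- fset_set [set: T]) f x)%N => x.
have xs : x \in fset_set [set: T] by rewrite in_fset_set //; apply/mem_set.
exact: (@leq_bigmax_seq _ _ xpredT f x xs isT).
Qed.

Lemma cover_inequality (R : realType) (X : complex) (x0 : vert X) :
  finite_complex X -> connected_complex X -> property_tau R (pi1 x0) ->
  exists C0 : R, forall C, C0 <= C -> 1 <= C ->
  forall N : subgroup (pi1 x0), normal_set N -> finite_index N ->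
    ((xi2 R (cover_of x0 N) - 1) * rho1 R (cover_of x0 N)
     - (C * (1 + ln (coset_index N)%:R))%:E
     <= C%:E * lne (counting (abelianization N)))%E.
Proof.
move=> [finV _ finF] conn tau.
have [a a0 short] := tau_short_reps tau.
have /boolp.choice[way wayP] := conn x0.
have [Q wayQ] := finite_seq_bound (fun y => size (way y)) finV.
have [m0 bm0] := finite_seq_bound (fun f : face X => size (bnd f)) finF.
pose m := m0.+2; have m2 : (2 <= m)%N by [].
have bm (f : face X) : (size (bnd f) <= m)%N.
  by apply: leq_trans (bm0 f) _; rewrite /m -addn2 leq_addr.
(* The factor [6 m] is the [2 m] of the small cycle bound times the 3 of the cycles of norm [3 L],
   and [a + Q + 1] bounds [L = k + Q + 1] relative to [1 + log n + log t]. *)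
exists ((6 * m)%:R * (a + Q%:R + 1)) => C C0C C1 N nN finN.
have C_gt0 : 0 < C by apply: lt_le_trans ltr01 C1.
rewrite /counting; case: asboolP => [finT|_]; last first.
  by rewrite /lne mulry gtr0_sg // mul1e leey.
set t := #|` fset_set (abelianization N)|; set n := coset_index N.
have n1 : (0 < n)%N by apply: coset_index_gt0.
have t1 : (0 < t)%N by apply: card_abelianization_gt0.
have lnn : 0 <= ln n%:R :> R by rewrite ln_ge0 // ler1n.
have lnt : 0 <= ln t%:R :> R by rewrite ln_ge0 // ler1n.
have [finD indD] := derived_index finN finT.
have [k sk ka] := short (derived_subgroup N) (derived_normal nN) finD.
have lnD : ln (coset_index (derived N))%:R <= ln n%:R + ln t%:R :> R.
  rewrite -lnM ?posrE ?ltr0n // -natrM ler_ln ?posrE ?ltr0n ?muln_gt0 ?n1 ?t1 //.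
    by rewrite ler_nat.
  exact: (@coset_index_gt0 _ (derived_subgroup N)).
have Lle : (6 * m)%:R * ((k + Q).+1)%:R <= C * (1 + ln n%:R) + C * ln t%:R :> R.
  apply: (@le_trans _ _ ((6 * m)%:R * (a + Q%:R + 1) * (1 + ln n%:R + ln t%:R))); last first.
    by rewrite -mulrDr ler_wpM2r // !addr_ge0.
  rewrite -mulrA ler_wpM2l // -addn1 !natrD.
  apply: (@le_trans _ _ (a * (1 + (ln n%:R + ln t%:R)) + Q%:R + 1)).
    rewrite !lerD2r; apply: le_trans ka _.
    by rewrite ler_wpM2l // lerD2l.
  have -> : (a + Q%:R + 1) * (1 + ln n%:R + ln t%:R) =
      a * (1 + (ln n%:R + ln t%:R)) + Q%:R + 1 + (Q%:R + 1) * (ln n%:R + ln t%:R) by ring.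
  by rewrite lerDl mulr_ge0 ?addr_ge0.
rewrite lne_EFin ?ltr0n // -EFinM leeBlDr // -EFinD.
have xi_le (K : int) : 0 <= K ->
    (forall z, range (@boundary2 (cover_of x0 N)) z ->
       l1norm z <= (k + Q).+1%:Z *+ 3 ->
       exists2 A, boundary2 A = z & l1norm A <= K) ->
    (xi2 R (cover_of x0 N) <= (1 + K *+ (2 * m))%:~R%:E)%E.
  move=> K0 fillK; apply: xi2_le.
  - exact: cover_face_finite wayP finN finF.
  - by rewrite addr_ge0 // mulrn_wge0.
  - by move=> A /(cover_span nN finT wayP wayQ sk m2 bm K0 fillK).
have rho0 := rho1_ge0 R (cover_of x0 N).
have xi0 := xi2_ge0 R (cover_of x0 N).
have rhs0 : 0 <= C * ln t%:R + C * (1 + ln n%:R).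
  by rewrite addr_ge0 ?mulr_ge0 ?addr_ge0 // ltW.
case rhoE : (rho1 R (cover_of x0 N)) rho0 => [r||] // rho0.
  rewrite lee_fin in rho0; have [r0|r0] := eqVneq r 0.
    by rewrite r0 mule0 lee_fin.
  have {r0}r_gt0 : 0 < r by rewrite lt_def r0.
  (* Cycles of norm at most [3 L] have fillings of norm at most [x], hence at most its floor, norms
     being integers. *)
  pose x : R := ((k + Q).+1 * 3)%:R / r.
  have x0' : 0 <= x by rewrite divr_ge0 // ltW.
  have K0 : 0 <= Num.floor x by rewrite floor_ge0.
  have := xi_le _ K0; rewrite -/x.
  have fillK : forall z, range (@boundary2 (cover_of x0 N)) z ->
       l1norm z <= (k + Q).+1%:Z *+ 3 ->
       exists2 A, boundary2 A = z & l1norm A <= Num.floor x.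
    move=> z zB zL; have rr : (r%:E <= rho1 R (cover_of x0 N))%E by rewrite rhoE.
    have [A Az AL] := rho1_fill r_gt0 rr zB.
    exists A => //; rewrite floor_ge_int; apply: le_trans AL _.
    rewrite ler_wpM2r ?invr_ge0 // -[_%:R]/(_%:Z%:~R) ler_int; apply: le_trans zL _.
    by rewrite -mulr_natr natz -PoszM.
  move=> /(_ fillK) xiK.
  case xiE : (xi2 R (cover_of x0 N)) xi0 xiK => [xi||] // xi0 xiK.
  rewrite -EFinB -EFinM lee_fin; rewrite lee_fin in xiK.
  apply: (@le_trans _ _ ((x *+ (2 * m)) * r)).
    rewrite ler_wpM2r // lerBlDl; apply: le_trans xiK _.
    rewrite intrD rmorphMn /= lerD2l lerMn2r; apply/orP; right.
    exact: floor_le.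
  rewrite mulrnAl /x divfK ?gt_eqF // addrC; apply: le_trans Lle.
  rewrite -mulr_natr -!natrM ler_nat; apply: eq_leq; ring.
(* With [rho1] infinite only the zero cycle is exact, so [K = 0] is allowed, [xi2] is at most 1, and
   the product is at most 0. *)
have := xi_le 0 (lexx _); rewrite mul0rn addr0 => xi1.
apply: (@le_trans _ _ 0%E); last by rewrite lee_fin.
apply: mule_le0_ge0; last exact: leey.
rewrite leeBlDr // add0e; apply: xi1 => z zB _.
by exists 0; rewrite ?l1norm0 // raddf0 (rho1_pinfty rhoE zB).
Qed.

(** * Residual towers *)

(** If the inverse letter does not occur, all traversals of the edge [a.1] have the sign of [a], and
    its coefficient cannot cancel. *)
Lemma walk_chain_eq0 (X : complex) a (p : seq (edge X * bool)) :
  walk_chain (a :: p) = 0 -> linv a \in p.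
Proof.
move=> c0; apply/contraT => nap.
have : coeff a.1 (walk_chain (a :: p)) * letter_sign a >= 1.
  rewrite /walk_chain big_cons coeffD coeffU eqxx mulr1 mulrDl -expr2.
  rewrite /letter_sign sqrr_sign lerDl raddf_sum /= mulr_suml.
  rewrite big_seq; apply: sumr_ge0 => b bp; rewrite coeffU /letter_sign.
  have [ba|] := eqVneq b.1 a.1; last by rewrite mulr0 mul0r.
  case: (eqVneq b.2 a.2) => [->|ba2]; first by rewrite mulr1 -expr2 sqrr_sign.
  case/negP: nap; suff <- : b = linv a by [].
  by case: b a ba ba2 {c0 bp} => [b1 b2] [a1 a2] /= -> ; case: b2; case: a2.
by rewrite c0 coeff0 mul0r.
Qed.

Lemma finite_pigeonhole (T : choiceType) (A : set T) (f : nat -> T) :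
  finite_set A -> (forall k, A (f k)) -> exists i d, f i = f (i + d.+1)%N.
Proof.
move=> finA fA; apply: contrapT => nf.
have injf : injective f.
  move=> i j fij; apply: contrapT => /eqP; rewrite neq_ltn => /orP[] ij; apply: nf.
    by exists i, (j - i.+1)%N; rewrite addnS -addSn subnKC.
  by exists j, (i - j.+1)%N; rewrite addnS -addSn subnKC.
have := @uniq_leq_size _ (map f (iota 0 #|` fset_set A|.+1)) (fset_set A).
rewrite map_inj_uniq // iota_uniq size_map size_iota => /(_ isT).
rewrite ltnn => H; suff : false by []; apply: H.
by move=> _ /mapP[k _ ->]; rewrite in_fset_set //; apply/mem_set.
Qed.

(** * Covers without nonzero exact 1-cycles *)

Section TreeCover.
Context (X : complex) (x0 : vert X) (N : subgroup (pi1 x0)).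
Local Notation letter := (edge X * bool)%type.
Local Notation pi1 := (pi1 x0).
Local Notation uvert := (uvert x0).
Local Notation Y := (cover_of x0 N).
Local Notation ext := (@extend X x0).
Local Notation qe := (\pi_(qedge (deck_action x0) N)).
Local Notation cls := (@homology_class Y).
Local Notation v0 := (@uvert0 X x0).

Lemma mem_ulift v p y (x : uedge x0 * bool) : cwalk X (uproj v) p y ->
  x \in ulift v p -> exists q b r, p = q ++ b :: r /\
    (val x.1 = (if b.2 then foldl ext v q else ext (foldl ext v q) b, b.1) /\ x.2 = b.2).
Proof.
elim: p v => [//|a p IH] v /andP[/eqP ea wp].
have [e ve ->] := ulift_cons p ea; rewrite inE => /orP[/eqP ->|xp].
  by exists [::], a, p.
have [|q [b [r [-> bx]]]] := IH (ext v a) _ xp; first by rewrite uproj_extend.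
by exists (a :: q), b, r.
Qed.

Hypothesis finT : finite_set (abelianization N).
Hypothesis noB : forall z, range (@boundary2 Y) z -> z = 0.

Lemma holonomyX n k : (N : set pi1) n -> (N : set pi1) (n ^+ k)%g /\
  holonomy N (n ^+ k)%g = holonomy N n *+ k.
Proof.
move=> Nn; elim: k => [|k [Nk IH]].
  by rewrite expg0 holonomy1; split=> //; apply: subgroup1.
by rewrite expgS holonomyM // IH mulrS; split=> //; apply: subgroupM.
Qed.

(** Two powers of [n] agree modulo the derived subgroup, so a positive multiple of the chain is
    exact, hence zero; 1-chains have no torsion. *)
Lemma holonomy_eq0 n : (N : set pi1) n -> lift_chain N v0 (val (repr n)) = 0.
Proof.
move=> Nn.
have [i [d E]] := finite_pigeonhole finT
  (fun k => ex_intro2 _ _ (n ^+ k)%g (holonomyX k Nn).1 erefl :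
     abelianization N (lcoset (derived N) (n ^+ k)%g)).
have [Ni hi] := holonomyX i Nn; have [Nd hd] := holonomyX (i + d.+1) Nn.
have : lcoset (derived N) (n ^+ i)%g (n ^+ (i + d.+1))%g.
  by rewrite E; apply: (lcoset_id (derived_subgroup N)).
move=> /(holonomy_lcoset Ni)[_]; rewrite hi hd mulrnDr -[RHS]addr0 => /addrI.
rewrite /holonomy -raddfMn => /homology_class0P/noB c0.
apply/eqP/freeg_eqP => e; rewrite coeff0.
have := congr1 (coeff e) c0; rewrite coeffMn coeff0 => /eqP.
by rewrite mulrn_eq0 /= => /eqP.
Qed.

(** Preceding the walk by a path from the base vertex to [v] shows that its class is the holonomy of
    [n], which vanishes. *)
Lemma closed_lift_chain n v p y : (N : set pi1) n -> cwalk X (uproj v) p y ->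
  foldl ext v p = deckv n v -> lift_chain N v p = 0.
Proof.
move=> Nn wp E; have yv : y = uproj v.
  by have := congr1 (@uproj X x0) E; rewrite uproj_deck (uproj_foldl wp).
have ws := valP (repr v); rewrite -/(uproj v) in ws.
have vs : foldl ext v0 (val (repr v)).2 = v.
  rewrite (foldl_uvert0 ws) -[RHS]reprK.
  by apply/uvert_piP; split=> //; apply: homotopic_refl.
rewrite yv in wp; have wsp := walk_cat ws wp.
have := @cls_endpoint _ _ N n _ _ _ Nn wsp ws; rewrite foldl_cat vs => /(_ E).
rewrite lift_chain_cat vs raddfD /= addrC => /addIr.
rewrite /holonomy (holonomy_eq0 Nn) raddf0 => H.
by apply: noB; apply/homology_class0P; exact: H.

Qed.

(* A closed walk has the form [a q a^-1 r] with [q] and [r] closed, because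
   its chain vanishes. *)
Lemma closed_lift n v p y : (N : set pi1) n -> cwalk X (uproj v) p y ->
  foldl ext v p = deckv n v -> foldl ext v p = v.
Proof.
have [k] := ubnP (size p); elim: k => // k IH in n v p y * => spk Nn wp E.
case: p => [//|a p] in spk wp E *.
have c0 := closed_lift_chain Nn wp E; have /andP[/eqP ea wp'] := wp.
have [e ve uE] := ulift_cons p ea.
have w1v : ext (ext v a) (linv a) = v by apply: extendK.
have uw1 : uproj (ext v a) = ltgt (@src X) (@tgt X) a by apply: uproj_extend.
move: c0; rewrite /lift_chain uE map_cons => /walk_chain_eq0.
move=> /mapP[[e' s] e'p [/eqmodP/asboolP[n' Nn' ee'] sE]].
have [|q [b [r [pE [ve' bs]]]]] := @mem_ulift (ext v a) p y (e', s) _ e'p.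
  by rewrite uw1.
move: ve'; rewrite /= -ee' /= ve => -[vE a1b].
have ba : b = linv a.
  by move: bs sE a1b => /= ->; rewrite /linv; case: (b) => b1 b2 /= <- <-.
move: wp'; rewrite pE => /walk_catE[z wq /= /andP[/eqP bz wr]].
set w2 := foldl ext (ext v a) q in vE.
have uw2 : uproj w2 = z by apply: uproj_foldl; rewrite uw1.
(* The letter [b] traverses backwards an [N]-translate of the first lifted edge, so [q] ends at a
   translate of its start and the induction hypothesis applies to it. *)
have w2E : w2 = deckv n' (ext v a).
  move: vE; rewrite {1}ba /=; case: ifP => _ vE //=.
  by rewrite deckv_extend vE -[a in RHS]linvK -ba extendK // bz uw2.
have w21 : w2 = ext v a.
  apply: (IH n' (ext v a) q z) => //; last by rewrite uw1.
  by move: spk; rewrite pE /= size_cat; lia.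
move: E; rewrite pE /= foldl_cat /= -/w2 w21 ba w1v => E.
apply: (IH n v r y) => //; first by move: spk; rewrite pE /= size_cat /=; lia.
by move: wr; rewrite ba ltgt_inv ea.
Qed.

(** The lift of a loop representing [n] ends at the translate by [n] of the base vertex; by
    [closed_lift] it closes up already in the universal cover, so the loop is null-homotopic. *)
Lemma tree_cover_trivial : (N : set pi1) = [set 1%g].
Proof.
apply/seteqP; split=> [n Nn|_ ->]; last exact: subgroup1.
have wn := valP (repr n).
have := @closed_lift n v0 (val (repr n)) x0 Nn; rewrite uproj_uvert0 => /(_ wn).
rewrite deckv_uvert0 => /(_ erefl) E.
rewrite /= -[n]reprK; apply/pi1_piP => /=.
have w0 : cwalk X x0 [::] x0 by rewrite /= eqxx.
exact: (proj1 (foldl_homotopic wn w0) E).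
Qed.

End TreeCover.

Lemma lognat_sublinear (R : realType) (A B : R) (n : nat -> nat) :
  0 <= A -> 0 <= B -> (forall i, (0 < n i)%N) ->
  (fun i => (n i)%:R : R) @ \oo --> +oo ->
  (fun i => (A * (1 + ln (n i)%:R) + B) / (n i)%:R) @ \oo --> (0 : R).
Proof.
move=> A0 B0 n0 /cvgryPgt noo; apply/cvgr0Pnorm_lt => eps eps0.
(* From [1 <= sqrt n] and [log n <= 2 sqrt n], the numerator is at most [D sqrt n]. *)
pose D := 3 * A + B; have D0 : 0 <= D by rewrite addr_ge0 // mulr_ge0.
near=> i; have ni0 : 0 < (n i)%:R :> R by rewrite ltr0n.
set x := Num.sqrt (n i)%:R : R; have x0 : 0 < x by rewrite sqrtr_gt0.
have xx : (n i)%:R = x ^+ 2 by rewrite sqr_sqrtr // ltW.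
have x1 : 1 <= x by rewrite -sqrtr1 ler_sqrt // ler1n.
have lnx : ln (n i)%:R <= 2 * x.
  rewrite xx lnXn // -[X in X <= _]mulr_natl ler_wpM2l //.
  exact/ltW/ln_sublinear.
have ln0 : 0 <= ln (n i)%:R :> R by rewrite ln_ge0 // ler1n.
rewrite ger0_norm ?divr_ge0 ?addr_ge0 ?mulr_ge0 ?addr_ge0 //.
rewrite ltr_pdivrMr //; apply: (@le_lt_trans _ _ (D * x)).
  rewrite /D mulrDl lerD //; last by rewrite ler_peMr.
  have -> : 3 * A * x = A * (x + 2 * x) by ring.
  by rewrite ler_wpM2l // lerD.
rewrite xx expr2 mulrA ltr_pM2r // mulrC -ltr_pdivrMr //.
rewrite -(@ltr_pXn2r _ 2) ?nnegrE ?divr_ge0 // ?ltW // -xx.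
near: i.
exact: noo.
Unshelve. all: by end_near. Qed.

(** Write [xi rho = (xi - 1) rho + rho] and absorb [rho <= m] into the error term. *)
Lemma residual_tower_inequality (R : realType) (X : complex) (x0 : vert X)
    (C : R) (N : nat -> subgroup (pi1 x0)) :
  finite_complex X -> 1 <= C ->
  (forall N : subgroup (pi1 x0), normal_set N -> finite_index N ->
    ((xi2 R (cover_of x0 N) - 1) * rho1 R (cover_of x0 N)
     - (C * (1 + ln (coset_index N)%:R))%:E
     <= C%:E * lne (counting (abelianization N)))%E) ->
  residual_tower R N ->
  exists2 u : nat -> R,
    (fun i => u i / (coset_index (N i))%:R) @ \oo --> (0 : R) &
    forall i, (xi2 R (cover_of x0 (N i)) * rho1 R (cover_of x0 (N i)) - (u i)%:E
       <= C%:E * lne (counting (abelianization (N i))))%E.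
Proof.
move=> [_ _ finF] C1 ineq [_ decN normN _ index_oo].
have [m bm] := finite_seq_bound (fun f : face X => size (bnd f)) finF.
have C_gt0 : 0 < C := lt_le_trans ltr01 C1.
have ni0 i : (0 < coset_index (N i))%N by apply: coset_index_gt0; case: (normN i).
exists (fun i => C * (1 + ln (coset_index (N i))%:R) + m%:R).
  by apply: lognat_sublinear => //; exact: ltW.
move=> i; have [nNi fNi] := normN i; have := ineq _ nNi fNi.
rewrite /counting; case: asboolP => [finT|_ _]; last first.
  by rewrite /lne mulry gtr0_sg // mul1e leey.
have lnn : 0 <= ln (coset_index (N i))%:R :> R by rewrite ln_ge0 // ler1n.
have t1 := card_abelianization_gt0 finT.
rewrite lne_EFin ?ltr0n // -EFinM.
set b := (C * ln _); have b0 : 0 <= b by rewrite mulr_ge0 ?(ltW C_gt0) // ln_ge0 // ler1n.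
set c := C * _; have c0 : 0 <= c by rewrite mulr_ge0 ?addr_ge0 ?(ltW C_gt0).
(* Otherwise [N i] would be trivial, all later terms would equal it, and the index would stay
   bounded. *)
have rho_fin : rho1 R (cover_of x0 (N i)) <> +oo%E.
  move=> rhoE; have N1 := tree_cover_trivial finT (fun z => rho1_pinfty rhoE).
  have NE j : (N (i + j)%N : set (pi1 x0)) = N i.
    elim: j => [|j IH]; first by rewrite addn0.
    apply/seteqP; split; first by rewrite addnS -IH; apply: decN.
    by rewrite N1 => _ ->; apply: subgroup1.
  have : \forall j \near \oo, (coset_index (N i))%:R < (coset_index (N j))%:R :> R.
    by move/cvgryPgt: index_oo; apply.
  move=> [j0 _ /(_ (i + j0)%N)/=]; rewrite leq_addl => /(_ isT).
  by rewrite NE ltxx.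
have rho_m : (rho1 R (cover_of x0 (N i)) <= m%:R%:E)%E.
  by apply: rho1_le_bnd => // F; have [f ->] := size_cover_bnd F.
have := xi2_ge0 R (cover_of x0 (N i)); have := rho1_ge0 R (cover_of x0 (N i)).
case: (rho1 R _) rho_fin rho_m => [r||] // _; rewrite !lee_fin => rm r0.
have [-> _ _|rn0] := eqVneq r 0.
  rewrite mule0 sub0e lee_fin; apply: le_trans b0.
  by rewrite oppr_le0 addr_ge0.
have r_gt0 : 0 < r by rewrite lt_def rn0.
case: (xi2 R _) => [x||] // _.
  rewrite -EFinB -!EFinM -!EFinB !lee_fin; lra.
by rewrite addye // gt0_mulye // addye.
Qed.

Theorem theorem0p1 (R : realType) (X0 : complex)
    (X0_finite : finite_complex X0) (X0_connected : connected_complex X0) :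
  exists C : R, forall x0 : vert X0, property_tau R (pi1 x0) ->
    (forall N : subgroup (pi1 x0), normal_set N -> finite_index N ->
       ((xi2 R (cover_of x0 N) - 1) * rho1 R (cover_of x0 N)
        - (C * (1 + ln (coset_index N)%:R))%:E
        <= C%:E * lne (counting (abelianization N)))%E)
    /\
    (forall N : nat -> subgroup (pi1 x0), residual_tower R N ->
       exists2 u : nat -> R,
         (fun i => u i / (coset_index (N i))%:R) @ \oo --> (0 : R) &
         forall i,
           (xi2 R (cover_of x0 (N i)) * rho1 R (cover_of x0 (N i)) - (u i)%:E
            <= C%:E * lne (counting (abelianization (N i))))%E).
Proof.
have /boolp.choice[c cP] : forall x0 : vert X0, exists C0 : R,
    property_tau R (pi1 x0) -> forall C, C0 <= C -> 1 <= C ->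
    forall N : subgroup (pi1 x0), normal_set N -> finite_index N ->
      ((xi2 R (cover_of x0 N) - 1) * rho1 R (cover_of x0 N)
       - (C * (1 + ln (coset_index N)%:R))%:E
       <= C%:E * lne (counting (abelianization N)))%E.
  move=> x0; case: (pselect (property_tau R (pi1 x0))) => [tau|ntau]; last by exists 0.
  by have [C0 C0P] := cover_inequality X0_finite X0_connected tau; exists C0.
have [finV _ _] := X0_finite.
(* The maximum over the finitely many vertices makes the constant independent of the base vertex;
   starting it at 1 ensures [1 <= C]. *)
pose C : R := \big[Num.max/1]_(x <- fset_set [set: vert X0]) c x.
exists C => x0 tau.
have C1 : 1 <= C by apply: bigmax_ge_id.
have cC : c x0 <= C.
  by apply: le_bigmax_seq => //; rewrite in_fset_set //; apply/mem_set.
have ineq := cP x0 tau C cC C1; split=> // N.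
exact: residual_tower_inequality.
Qed.
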